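(* Let $\psi:\mathbb{N}\to\mathbb{R}$ be a non-negative function, and suppose there is a constant $\varepsilon>0$ such that $$\sum_{n=1}^\infty \frac{\psi(n)\varphi(n)}{n(\log n)^\varepsilon}=\infty.$$ For each $n\ge 1$ let $$\mathcal{E}_n=\bigcup_{\substack{1\le a\le n,\\ \gcd(a,n)=1}}\left(\frac{a-\psi(n)}{n},\frac{a+\psi(n)}{n}\right)\subset \mathbb{R}/\mathbb{Z},$$ and let $W(\psi)$ be the set of $x\in[0,1]$ that lie in infinitely many of the sets $\mathcal{E}_n$. Then $\lambda(W(\psi))=1$, where $\lambda$ is Lebesgue measure. Equivalently, for almost every real $x$ there are infinitely many pairs $(a,n)$ with $n\ge1$ and $\gcd(a,n)=1$ such that $|nx-a|<\psi(n)$.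
   Context: $\varphi$ denotes Euler's totient function. Throughout, $\log x$ is understood as $\max(1,\log x)$, so that all logarithms are positive and well defined. *)

(* Defs.v *)
(* MathComp / MathComp-Analysis *)
From HB Require Import structures.
From mathcomp Require Import all_boot all_order all_algebra.
From mathcomp Require Import all_classical all_reals all_analysis.

Set Implicit Arguments.
Unset Strict Implicit.
Unset Printing Implicit Defensive.

Import Order.TTheory GRing.Theory Num.Theory.
Import numFieldNormedType.Exports.

Local Open Scope classical_set_scope.
Local Open Scope ring_scope.

(* The convention "log x means max(1, log x)". *)
Definition log1 {R : realType} (x : R) : R := Num.max 1 (ln x).

(* A subset of R/Z is represented by its preimage in R, a Z-periodic set:
   mod1 A is the preimage of the image of A under R -> R/Z. *)
Definition mod1 {R : realType} (A : set R) : set R :=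
  [set x | exists k : int, A (x + k%:~R)].

Definition approx_set {R : realType} (psi : nat -> R) (n : nat) : set R :=
  mod1 (\bigcup_(a in [set a : nat | (1 <= a <= n)%N /\ gcdn a n = 1%N])
          [set` `](a%:R - psi n) / n%:R, (a%:R + psi n) / n%:R[]).

(* "Infinitely many of the sets E_n" means for infinitely many indices n. *)
Definition limsup_approx {R : realType} (psi : nat -> R) : set R :=
  [set x : R | x \in `[0, 1] /\
           infinite_set [set n : nat | (1 <= n)%N /\ approx_set psi n x]].

Definition coprime_solutions {R : realType} (psi : nat -> R) (x : R) :
    set (int * nat) :=
  [set p | [/\ (1 <= p.2)%N, gcdz p.1 p.2%:Z = 1
             & `|p.2%:R * x - p.1%:~R| < psi p.2]].

(* Main.v *)
Require Import Defs.
From HB Require Import structures.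
From mathcomp Require Import all_boot all_order all_algebra.
From mathcomp Require Import all_classical all_reals all_analysis.
From mathcomp Require Import measurable_realfun.
From mathcomp Require Import zify ring lra.

Set Implicit Arguments.
Unset Strict Implicit.
Unset Printing Implicit Defensive.

Import Order.TTheory GRing.Theory Num.Theory.
Import numFieldNormedType.Exports.

Local Open Scope classical_set_scope.
Local Open Scope ring_scope.

(* Write s(n) = psi(n) phi(n) / n.  Group the n into the blocks 2^2^h <= n < 2^2^(h+1), on which
   log n is constant up to a factor.  Extra divergence gives infinitely many h whose block has
   mass at least 2^K, where K is a fixed proportion of h.  On such a block replace psi by
   psi / 2^k for 1 <= k <= K.  The overlap of the neighbourhoods of denominators m and n is
   governed by the number of integers c in a range of length X prime to N = mn / gcd(m, n)^2,
   weighted by c / phi(c).  Averaged over k this number is O(X phi(N) / N): for X >= 2^K by a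
   Hall-Tenenbaum argument, while the shorter ranges sum over k to the logarithmic mean
   of the weight, bounded by an Euler product; the primes p > 2^K dividing N only matter up
   to a constant because K is proportional to h.  So some k makes the block quasi-independent,
   and the Chung-Erdos inequality yields a lower bound for the measure of the limsup set which
   depends only on epsilon.

   Uniformity in psi turns this into full measure.  If the n with 2-adic valuation r carry a
   divergent series for some r, intersect the limsup sets of psi / 2^nu restricted to these n:
   the intersection has positive measure and is mapped into itself by x -> 2x + 2^-r.
   Otherwise the n with valuation at least r carry a divergent series for every r, and the
   intersection of their limsup sets is invariant under dyadic shifts.  Lebesgue's density
   theorem concludes in both cases. *)

(** * Chebyshev and Mertens bounds *)

(** The obstacle lies in the short ranges: among the c up to X, a prime p > X dividing N does not
    thin out the integers prime to N, although it lowers phi(N) / N, so a single scale may overshoot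
    X phi(N) / N. Dividing psi by 2^k shortens a range Y to Y / 2^k. With the normalising factor
    2^k, the scales at which c still lies in the range give c a total weight O(Y / c). The
    logarithmic mean over c <= 2^K obtained in this way is O(K phi(N) / N), no more than K
    well-behaved scales would cost. Only the primes above 2^K then have to be controlled, and the
    sum of 1 / p over those dividing N is bounded as soon as log log n = O(K). The condition on the
    mass of a block has another origin: each fraction also meets itself, which costs up to 2^K times
    the mass, and a block of mass at least 2^K absorbs this into the square of its mass. Both
    requirements on K are compatible because eps is fixed: K may be taken as h / E with E about 2 /
    eps. *)

Lemma ln_nat_sum (R : realType) (c M : nat) : (0 < c <= M)%N ->
  ln (c%:R : R) = \sum_(0 <= p < M.+1 | prime p) (logn p c)%:R * ln p%:R.
Proof.
case/andP=> c0 cM; rewrite -[in LHS](partnT c0) (widen_partn _ cM).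
rewrite natr_prod.
have lnprod (I : Type) (s : seq I) (F : I -> nat) :
    (forall i, 0 < F i)%N ->
    ln (\prod_(i <- s) (F i)%:R : R) = \sum_(i <- s) ln (F i)%:R.
  move=> F0; elim: s => [|i s IH]; first by rewrite !big_nil ln1.
  rewrite !big_cons lnM ?IH// posrE ?ltr0n// prodr_gt0// => j _.
  by rewrite ltr0n.
rewrite lnprod; last first.
  by move=> [|p]; [rewrite lognE|rewrite expn_gt0].
rewrite [RHS]big_mkcond/=; apply: eq_bigr => p _.
case: ifPn => [pp|npp]; first by rewrite natrX lnXn ?ltr0n ?prime_gt0// mulr_natl.
by rewrite lognE (negbTE npp)/= expn0 ln1.
Qed.

Lemma logn_indic_sum (p c M : nat) : prime p -> (0 < c <= M)%N ->
  logn p c = (\sum_(1 <= j < M.+1) (p ^ j %| c))%N.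
Proof.
move=> pp /andP[c0 cM].
have lM : (logn p c <= M)%N.
  by rewrite (leq_trans _ cM)// ltnW// ltn_logl.
under eq_bigr do rewrite pfactor_dvdn//.
rewrite big_add1/= (big_cat_nat (n := logn p c))//=.
rewrite [X in (_ + X)%N]big_nat_cond [X in (_ + X)%N]big1 ?addn0; last first.
  by move=> i; rewrite andbT => /andP[li _]; rewrite ltnNge li.
rewrite big_nat_cond (eq_bigr (fun=> 1%N)); last first.
  by move=> i /andP[/andP[_ ->]].
by rewrite -big_nat_cond sum_nat_const_nat subn0 muln1.
Qed.

Lemma ln_fact_sum (R : realType) (n : nat) :
  ln (n`!%:R : R) =
  \sum_(0 <= p < n.+1 | prime p) (\sum_(1 <= k < n.+1) (n %/ p ^ k))%N%:R * ln p%:R.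
Proof.
rewrite (@ln_nat_sum _ _ n`!) ?fact_gt0 ?leqnn//.
have nf : (n <= n`!)%N by case: n => // n; rewrite factS leq_pmulr ?fact_gt0.
rewrite (big_cat_nat (n := n.+1))//= ?ltnS// [X in _ + X]big1_seq ?addr0.
  by apply: eq_bigr => p pp; rewrite logn_fact.
move=> p /andP[pp]; rewrite mem_index_iota => /andP[np _].
rewrite logn_fact// big_nat_cond big1 ?mul0r// => k /andP[/andP[k1 _] _].
rewrite divn_small// (leq_trans np)// -{1}(expn1 p) leq_pexp2l// prime_gt0//.
Qed.

(** Chebyshev's second function, the logarithm of lcm(1, ..., n): [trunc_log p n] counts the powers
    p^j <= n with j >= 1. *)
Definition cheb_psi (R : realType) (n : nat) : R :=
  \sum_(0 <= p < n.+1 | prime p) (trunc_log p n)%:R * ln p%:R.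

Lemma trunc_log_indic_sum (p n M : nat) : prime p -> (0 < n <= M)%N ->
  trunc_log p n = (\sum_(1 <= j < M.+1) (p ^ j <= n))%N.
Proof.
move=> pp /andP[n0 nM]; have p1 := prime_gt1 pp.
have lM : (trunc_log p n <= M)%N.
  rewrite (leq_trans _ nM)// ltnW// (leq_trans _ (trunc_logP p1 n0))//.
  exact: ltn_expl.
have E j : (p ^ j <= n)%N = (j <= trunc_log p n)%N.
  apply/idP/idP => [|jl]; first exact: trunc_log_max.
  by rewrite (leq_trans _ (trunc_logP p1 n0))// leq_pexp2l// ltnW.
under eq_bigr do rewrite E.
rewrite big_add1/= (big_cat_nat (n := trunc_log p n))//=.
rewrite [X in (_ + X)%N]big_nat_cond [X in (_ + X)%N]big1 ?addn0; last first.
  by move=> i; rewrite andbT => /andP[li _]; rewrite ltnNge li.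
rewrite big_nat_cond (eq_bigr (fun=> 1%N)); last first.
  by move=> i /andP[/andP[_ ->]].
by rewrite -big_nat_cond sum_nat_const_nat subn0 muln1.
Qed.

Lemma cheb_psiE (R : realType) (n M : nat) : (0 < n <= M)%N ->
  cheb_psi R n = \sum_(0 <= p < M.+1 | prime p)
                   \sum_(1 <= j < M.+1) (p ^ j <= n)%N%:R * ln p%:R.
Proof.
case/andP=> n0 nM.
rewrite /cheb_psi [RHS](big_cat_nat (n := n.+1))//= ?ltnS//.
rewrite [X in _ = _ + X]big1_seq ?addr0; last first.
  move=> p /andP[pp]; rewrite mem_index_iota => /andP[np _].
  rewrite big_nat_cond big1// => j /andP[/andP[j1 _] _].
  rewrite leqNgt (leq_trans np) ?mul0r//.
  by rewrite -{1}(expn1 p) leq_pexp2l// prime_gt0.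
apply: eq_bigr => p pp; rewrite (@trunc_log_indic_sum _ _ M) ?n0// natr_sum.
by rewrite mulr_suml.
Qed.

(** By Legendre's formula the exponent of p in the central binomial coefficient is the sum over q =
    p^k of floor(2n / q) - 2 floor(n / q). Each term is nonnegative, and it is 1 when n < q <= 2n,
    that is, when q is counted on the left but not in [trunc_log p n]. *)
Lemma central_bin_logn (p n : nat) : prime p -> (0 < n)%N ->
  (trunc_log p n.*2 <= logn p 'C(n.*2, n) + trunc_log p n)%N.
Proof.
move=> pp n0; have n20 : (0 < n.*2)%N by rewrite double_gt0.
have nn2 : (n <= n.*2)%N by rewrite -addnn leq_addr.
have H : logn p n.*2`! = (logn p 'C(n.*2, n) + (logn p n`!).*2)%N.
  rewrite -(bin_fact nn2) -addnn addnK !lognM ?muln_gt0 ?fact_gt0 ?bin_gt0 ?leq_addr//.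
  by rewrite (addnn (logn p n`!)).
have H2 : logn p n`! = (\sum_(1 <= k < n.*2.+1) n %/ p ^ k)%N.
  rewrite logn_fact// [RHS](big_cat_nat (n := n.+1))//= ?ltnS//.
  rewrite [X in _ = (_ + X)%N]big_nat_cond [X in _ = (_ + X)%N]big1 ?addn0// =>
      k /andP[/andP[k1 _] _].
  rewrite divn_small// (leq_trans k1)// ltnW// ltn_expl// prime_gt1//.
rewrite -(leq_add2r (logn p n`!).*2) addnAC -H H2 logn_fact//.
rewrite (@trunc_log_indic_sum _ n.*2 n.*2) ?n20 ?leqnn// (@trunc_log_indic_sum _ n n.*2) ?n0//.
rewrite -(addnn (\sum_(1 <= k < n.*2.+1) n %/ p ^ k)%N) -!big_split/= leq_sum// => k _.
set q := (p ^ k)%N; have q0 : (0 < q)%N by rewrite expn_gt0 prime_gt0.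
have [qn|nq] := leqP q n.
  have -> : (q <= n.*2)%N by rewrite (leq_trans qn).
  rewrite addnC leq_add2r leq_divRL// mulnDl -addnn leq_add// leq_trunc_div//.
rewrite (divn_small nq) !addn0; case: (leqP q n.*2) => //= h.
by rewrite divn_gt0//; lia.
Qed.

Lemma ln_two_le1 (R : realType) : ln (2%:R : R) <= 1.
Proof.
by have := @le_ln1Dx R 1; rewrite -[1 + 1]/(2%:R); apply; lra.
Qed.

Lemma ln_nat_ge0 (R : realType) (n : nat) : 0 <= ln (n%:R : R).
Proof.
case: n => [|n]; first by rewrite ln0.
by rewrite ln_ge0// ler1n.
Qed.

Lemma cheb_psi_ge0 (R : realType) n : 0 <= cheb_psi R n.
Proof. by apply: sumr_ge0 => p _; rewrite mulr_ge0// ln_nat_ge0. Qed.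

Lemma cheb_psi0 (R : realType) : cheb_psi R 0 = 0.
Proof. by rewrite /cheb_psi big_mkcond/= big_nat1. Qed.

Lemma cheb_psi_le (R : realType) : {homo cheb_psi R : m n / (m <= n)%N >-> m <= n}.
Proof.
move=> m n mn; have [->|m0] := posnP m.
  by rewrite cheb_psi0 cheb_psi_ge0.
rewrite !(@cheb_psiE _ _ n) ?m0 ?mn ?leqnn ?(leq_trans m0 mn)//.
apply: ler_sum => p pp; apply: ler_sum => j _.
rewrite ler_wpM2r ?ln_nat_ge0// ler_nat.
by case: (leqP _ m) => //= h; rewrite (leq_trans h mn).
Qed.

Lemma cheb_psi_double (R : realType) (n : nat) :
  cheb_psi R n.*2 <= cheb_psi R n + n.*2%:R.
Proof.
have [->|n0] := posnP n; first by rewrite double0 addr0.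
have n20 : (0 < n.*2)%N by rewrite double_gt0.
have nn2 : (n <= n.*2)%N by rewrite -addnn leq_addr.
have b0 : (0 < 'C(n.*2, n))%N by rewrite bin_gt0.
have Cle : ('C(n.*2, n) <= 2 ^ n.*2)%N.
  rewrite -[2%N]/(1 + 1)%N expnDn (bigD1 (inord n))//= inordK ?ltnS//.
  by rewrite !exp1n !muln1 leq_addr.
have lnC : ln ('C(n.*2, n)%:R : R) <= n.*2%:R.
  apply: (@le_trans _ _ (ln ((2 ^ n.*2)%N%:R : R))).
    by rewrite ler_ln ?posrE ?ltr0n ?expn_gt0// ler_nat.
  by rewrite natrX lnXn// lerMn2r ln_two_le1 orbT.
apply: le_trans (lerD (lexx _) lnC).
(* A common range of primes for n, 2n and the binomial coefficient, which is at most 2^(2n). *)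
set M := (2 ^ n.*2)%N.
have nM : (n.*2 <= M)%N by rewrite ltnW// ltn_expl.
have ext k : (0 < k <= M)%N -> cheb_psi R k =
    \sum_(0 <= p < M.+1 | prime p) (trunc_log p k)%:R * ln p%:R.
  move=> kM; rewrite (cheb_psiE R kM); apply: eq_bigr => p pp.
  by rewrite (trunc_log_indic_sum pp kM) natr_sum mulr_suml.
rewrite (ext n.*2) ?n20// (ext n) ?n0 ?(leq_trans nn2)//.
rewrite (@ln_nat_sum _ _ M) ?b0// -big_split/=; apply: ler_sum => p pp.
rewrite -mulrDl ler_wpM2r ?ln_nat_ge0// -natrD ler_nat addnC.
exact: central_bin_logn.
Qed.

(** Doubling gives the constant 2 at powers of two; rounding n up to the next power costs another
    factor 2. *)
Lemma cheb_psi_linear (R : realType) (n : nat) : cheb_psi R n <= 4 * n%:R.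
Proof.
have pow k : cheb_psi R (2 ^ k) <= 2 * (2 ^ k)%N%:R.
  elim: k => [|k IH].
    by rewrite expn0 /cheb_psi big_mkcond/= big_ltn// big_nat1/= addr0 mulr1.
  rewrite expnS mul2n (le_trans (cheb_psi_double _ _))//.
  by rewrite -mul2n natrM; lra.
have [->|n0] := posnP n.
  by rewrite cheb_psi0 mulr0.
have /andP[l1 l2] := trunc_log_bounds (erefl : 1 < 2)%N n0.
apply: le_trans (cheb_psi_le _ (ltnW l2)) _.
apply: le_trans (pow _) _.
rewrite expnS natrM; move: l1; rewrite -(ler_nat R); lra.
Qed.

(** The upper half of Mertens' first theorem. Legendre's formula for n! is compared with ln n! <= n
    ln n; replacing n / p by its integer part costs at most Chebyshev's function, hence the 4. *)
Lemma sum_ln_prime_div_le (R : realType) (n : nat) : (0 < n)%N ->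
  \sum_(0 <= p < n.+1 | prime p) ln p%:R / p%:R <= ln (n%:R : R) + 4.
Proof.
move=> n0.
have n0R : (0 : R) < n%:R by rewrite ltr0n.
have fact_le : ln (n`!%:R : R) <= n%:R * ln n%:R.
  rewrite mulr_natl -lnXn// ler_ln ?posrE ?exprn_gt0 ?ltr0n ?fact_gt0//.
  by rewrite -natrX ler_nat; elim: n {n0 n0R} => // n IH;
      rewrite factS expnS leq_mul// (leq_trans IH)//; case: n {IH} => // n; rewrite leq_exp2r.
have lb : n%:R * (\sum_(0 <= p < n.+1 | prime p) ln p%:R / p%:R) - cheb_psi R n <= ln (n`!%:R : R).
  rewrite ln_fact_sum /cheb_psi mulr_sumr -sumrB.
  rewrite big_nat_cond [leRHS]big_nat_cond; apply: ler_sum => p /andP[/andP[_ pn] pp].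
  rewrite mulrCA mulrC -mulrBl ler_wpM2r ?ln_nat_ge0//.
  have p0 := prime_gt0 pp.
  have t1 : (1 <= trunc_log p n)%N by rewrite trunc_log_max ?expn1 ?prime_gt1.
  have : (n %/ p <= \sum_(1 <= k < n.+1) (n %/ p ^ k))%N.
    by rewrite big_ltn// expn1 leq_addr.
  rewrite -(ler_nat R); apply: le_trans.
  have : (n%:R : R) / p%:R <= (n %/ p)%N%:R + 1.
    rewrite ler_pdivrMr ?ltr0n// natr1 -natrM ler_nat ltnW//.
    by rewrite ltn_ceil.
  move: t1; rewrite -(ler_nat R); lra.
have := cheb_psi_linear R n.
have Y := le_trans lb fact_le => X.
rewrite -(ler_pM2l n0R) mulrDr; lra.
Qed.

Lemma ln_le_subr1 (R : realType) (x : R) : 0 < x -> ln x <= x - 1.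
Proof.
by move=> x0; have := @le_ln1Dx R (x - 1); rewrite addrCA subrr addr0; apply; lra.
Qed.

Lemma ln_two_ge (R : realType) : 2^-1 <= ln (2 : R).
Proof.
have := @ln_le_subr1 R 2^-1; rewrite invr_gt0 ltr0n lnV ?posrE// => /(_ isT).
lra.
Qed.

Lemma ln_nat_gt0 (R : realType) (n : nat) : (1 < n)%N -> 0 < ln (n%:R : R).
Proof. by move=> n1; rewrite ln_gt0// ltr1n. Qed.

(** Partial summation in the form of a monotonicity. The quantity [G] is nonincreasing: a new prime
    p adds 1 / p to [P] and removes the same amount through [A], while ln (L / L') <= L / L' - 1
    takes care of the change of logarithm from L to L'. The constant is the value of [G] at 2. *)
Lemma sum_inv_prime_le (R : realType) : exists C : R, forall n, (2 <= n)%N ->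
  \sum_(0 <= p < n.+1 | prime p) (p%:R)^-1 <= ln (ln n%:R) + C.
Proof.
pose A n : R := \sum_(0 <= p < n.+1 | prime p) ln p%:R / p%:R.
pose P n : R := \sum_(0 <= p < n.+1 | prime p) (p%:R)^-1.
pose G n : R := P n + (ln n%:R + 4 - A n) / ln n%:R - ln (ln n%:R).
exists (G 2%N) => n n2.
have A_le m : (2 <= m)%N -> 0 <= ln (m%:R : R) + 4 - A m.
  by move=> m2; have := @sum_ln_prime_div_le R m (ltnW m2); rewrite -/(A m); lra.
suff GG : G n <= G 2%N.
  have : 0 <= (ln n%:R + 4 - A n) / ln n%:R.
    by rewrite divr_ge0 ?A_le// ltW// ln_nat_gt0.
  by move: GG; rewrite {1}/G -/(P n); lra.
elim: n n2 => // n IH; rewrite leq_eqVlt => /predU1P[<-//|n2].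
apply: le_trans (IH n2).
have L0 : 0 < ln (n%:R : R) by rewrite ln_nat_gt0.
have LL : ln (n%:R : R) <= ln (n.+1%:R : R).
  by rewrite ler_ln ?posrE ?ltr0n ?ler_nat// ltnW.
have L'0 := lt_le_trans L0 LL.
have An := A_le n n2.
rewrite /G; set L := ln (n%:R : R) in L0 LL An *; set L' := ln (n.+1%:R : R) in LL L'0 *.
have step : P n.+1 + (L' + 4 - A n.+1) / L' = P n + (L' + 4 - A n) / L'.
  have recr (F : nat -> R) : \sum_(0 <= p < n.+2 | prime p) F p =
      \sum_(0 <= p < n.+1 | prime p) F p + (if prime n.+1 then F n.+1 else 0).
    by rewrite big_mkcond big_nat_recr//= -big_mkcond.
  rewrite /P /A !recr.
  rewrite -/L'; case: ifP => _; last by rewrite !addr0.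
  field; rewrite ?gt_eqF// ?ltr0n//.
rewrite step.
have : ln (L / L') <= L / L' - 1 by apply: ln_le_subr1; rewrite divr_gt0.
rewrite ln_div ?posrE// => lnL.
have : (L + 4 - A n) / L' <= (L + 4 - A n) / L.
  by rewrite ler_wpM2l// lef_pV2 ?posrE.
rewrite -[leRHS]addr0.
have -> : (L' + 4 - A n) / L' = 1 + (L + 4 - A n) / L' - L / L'.
  by field; rewrite gt_eqF.
lra.
Qed.

(** * Euler products *)

(** The product runs over all primes up to a free bound [M], so that the products of several
    integers can share one range and be compared factor by factor. *)
Lemma totient_ratioE (R : realType) (n M : nat) : (0 < n <= M)%N ->
  (totient n)%:R / n%:R =
  \prod_(0 <= p < M.+1 | prime p) (if (p %| n)%N then 1 - (p%:R)^-1 else 1) :> R.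
Proof.
case/andP=> n0 nM.
have -> : \prod_(0 <= p < M.+1 | prime p) (if (p %| n)%N then 1 - (p%:R)^-1 else 1) =
    \prod_(p <- primes n) (1 - (p%:R)^-1) :> R.
  rewrite -big_mkcondr/= -big_filter; apply: perm_big; apply: uniq_perm.
  - by rewrite filter_uniq// iota_uniq.
  - exact: primes_uniq.
  - move=> p; rewrite mem_filter mem_index_iota mem_primes n0/= ltnS.
    case pp: (prime p) => //=; case: (boolP (p %| n)%N) => //= /dvdn_leq h.
    by rewrite (leq_trans (h n0)).
rewrite totientE// [n in _ / n%:R]prod_prime_decomp// prime_decompE big_map/=.
rewrite !natr_prod -prodf_div; apply: eq_big_seq => p.
rewrite mem_primes => /and3P[pp _ pn].
have l0 : (0 < logn p n)%N by rewrite logn_gt0 mem_primes pp n0.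
rewrite -[in X in _ / X](prednK l0) expnS !natrM.
have p0 : (0 : R) < p%:R by rewrite ltr0n prime_gt0.
have q0 : (0 : R) < (p ^ (logn p n).-1)%N%:R by rewrite ltr0n expn_gt0 prime_gt0.
have -> : p.-1%:R = p%:R - 1 :> R by rewrite -subn1 natrB// prime_gt0.
by field; rewrite !gt_eqF.
Qed.

Lemma coprime_totient_sum_le (R : realType) (N X : nat) : (0 < N)%N ->
  \sum_(1 <= c < X.+1 | coprime c N) ((totient c)%:R)^-1 <=
  expR (\sum_(0 <= p < X.+1 | prime p && ~~ (p %| N)%N) p%:R / (p%:R - 1) ^+ 2) :> R.
Proof.
move=> N0.
pose sm z c := [&& (0 < c)%N, coprime c N & all (fun p => p < z)%N (primes c)].
pose D z : R := \sum_(c < X.+1 | sm z c) ((totient c)%:R)^-1.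
suff main z : D z <= expR (\sum_(0 <= p < z | prime p && ~~ (p %| N)%N) p%:R / (p%:R - 1) ^+ 2).
  apply: le_trans (main X.+1); rewrite /D le_eqVlt; apply/orP; left; apply/eqP.
  rewrite -(big_mkord (sm X.+1) (fun c => ((totient c)%:R)^-1)).
  rewrite [RHS]big_ltn_cond//= big_nat_cond [RHS]big_nat_cond; apply: eq_bigl => c.
  case: (boolP (1 <= c < X.+1)%N) => //= /andP[c0 cX]; rewrite /sm c0/=.
  case: (coprime c N) => //=; apply/esym/allP => p; rewrite mem_primes => /and3P[_ _ /dvdn_leq h].
  by rewrite (leq_ltn_trans (h c0)).
elim: z => [|z IH].
  rewrite big_geq// expR0 /D.
  apply: (@le_trans _ _ (\sum_(c < X.+1 | c == 1%N :> nat) 1)).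
    rewrite [leLHS]big_mkcond [leRHS]big_mkcond; apply: ler_sum => c _.
    case: ifP => [/and3P[c0 _ al]|_]; last by case: ifP.
    have : (c <= 1)%N.
      rewrite leqNgt; apply/negP => c1.
      by move/allP/(_ (pdiv c)): al; rewrite mem_primes pdiv_prime// pdiv_dvd c0 => /(_ isT).
    move=> c1; have -> : c = 1%N :> nat by apply/eqP; rewrite eqn_leq c1.
    by rewrite eqxx /= invr1.
  rewrite sumr_const (_ : 1 = 1%:R)// ler_nat; apply/card_le1_eqP => x y.
  by rewrite !unfold_in => /eqP xE /eqP yE; apply/val_inj; rewrite /= xE yE.
have DE : ~~ (prime z && ~~ (z %| N)%N) -> D z.+1 = D z.
  move=> nz; apply: eq_bigl => c; rewrite /sm.
  case c0: (0 < c)%N => //=; case: (boolP (coprime c N)) => //= cN.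
  apply: eq_in_all => p; rewrite mem_primes => /and3P[pp _ pc].
  rewrite ltnS leq_eqVlt; case: eqP => // pz; subst z.
  move: nz; rewrite pp/= negbK => pN.
  have := dvdn_gcd p c N; rewrite pc pN/= (eqP cN) dvdn1 => /eqP p1.
  by move: pp; rewrite p1.
rewrite big_mkcond big_nat_recr//= -big_mkcond/=.
case: ifPn => [/andP[pz zN]|nz]; last by rewrite addr0 DE.
have z0 := prime_gt0 pz; have z1 := prime_gt1 pz.
rewrite expRD.
pose a j : R := ((totient (z ^ j))%:R)^-1.
have aj0 j : 0 <= a j by rewrite invr_ge0.
have step1 : D z.+1 <= (\sum_(j < X.+1) a j) * D z.
  rewrite /D mulr_suml.
  under [leRHS]eq_bigr do rewrite mulr_sumr.
  apply: (@le_trans _ _ (\sum_(c < X.+1) \sum_(j < X.+1) \sum_(d < X.+1 | sm z d)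
    (z ^ j * d == c)%N%:R * (a j * ((totient d)%:R)^-1))).
    rewrite [leLHS]big_mkcond/=; apply: ler_sum => c _.
    have pos j (d : 'I_X.+1) : 0 <= (z ^ j * d == c)%N%:R * (a j * ((totient d)%:R)^-1) :> R.
      by rewrite !mulr_ge0// invr_ge0.
    case: ifP => [/and3P[c0 cN al]|_]; last first.
      by apply: sumr_ge0 => j _; apply: sumr_ge0 => d _.
    have cX := ltn_ord c.
    have jX : (logn z c < X.+1)%N by rewrite (ltn_trans _ cX)// ltn_logl.
    have dX : (c`_(z^') < X.+1)%N by rewrite (leq_ltn_trans _ cX)// dvdn_leq// dvdn_part.
    have cE : (z ^ logn z c * c`_(z^'))%N = c by rewrite -p_part partnC.
    have d0 : (0 < c`_(z^'))%N by rewrite part_gt0.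
    rewrite (bigD1 (Ordinal jX))//= (bigD1 (Ordinal dX))/=; last first.
      rewrite /sm d0/= (coprime_dvdl _ cN) ?dvdn_part//=.
      apply/allP => p; rewrite primes_part mem_filter => /andP[pz' pc].
      have := allP al p pc; rewrite ltnS leq_eqVlt => /predU1P[pE|//].
      by move: pz'; rewrite pE !inE eqxx.
    rewrite cE eqxx mul1r -addrA -[leLHS]addr0 lerD//.
      rewrite /a -invfM -natrM -totient_coprime ?cE//.
      by rewrite -p_part coprime_partC.
    by rewrite addr_ge0// sumr_ge0// => *; apply: sumr_ge0 => *.
  rewrite exchange_big/=; apply: ler_sum => j _.
  rewrite exchange_big/=; apply: ler_sum => d _.
  rewrite -mulr_suml ler_piMl//; first by rewrite mulr_ge0// invr_ge0.
  have [h|h] := ltnP (z ^ j * d)%N X.+1.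
    rewrite (bigD1 (Ordinal h))//= eqxx big1 ?addr0// => i.
    by rewrite -val_eqE/= eq_sym => /negbTE ->.
  rewrite big1// => i _; case: eqP => // E; move: h.
  by rewrite E leqNgt ltn_ord.
apply: (le_trans step1); rewrite mulrC ler_pM//.
- by apply: sumr_ge0 => *; rewrite invr_ge0.
- exact: sumr_ge0.
have zR : (2 : R) <= z%:R by rewrite ler_nat.
apply: le_trans (expR_ge1Dx _).
(* The geometric tail is kept in the bound so that the induction closes; it is dropped
   afterwards. *)
have geo J : \sum_(j < J.+1) a j <= 1 + z%:R / (z%:R - 1) ^+ 2 - (z%:R
    * (z%:R^-1)^+J) / (z%:R - 1) ^+ 2.
  elim: J => [|J IHJ].
    by rewrite big_ord_recl big_ord0 /a expn0 /= expr0 invr1; lra.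
  rewrite big_ord_recr/=; apply: le_trans (lerD IHJ (lexx _)) _.
  rewrite /a totient_pfactor//= natrM natrX (exprS (z%:R^-1) J) !exprVn.
  have -> : z.-1%:R = z%:R - 1 :> R by rewrite -subn1 natrB.
  have : (z%:R : R) ^+ J != 0 by rewrite expf_neq0 ?gt_eqF//; lra.
  move: (_ ^+ J) => v v0; rewrite le_eqVlt; apply/orP; left; apply/eqP.
  by field; rewrite v0 !gt_eqF//; lra.
apply: le_trans (geo X) _.
by rewrite gerBl// divr_ge0 ?exprn_ge0// ?mulr_ge0 ?exprn_ge0 ?invr_ge0//; lra.
Qed.

(** * Integers prime to N, weighted by c / phi(c) *)

Lemma prod_ratio_pos (R : realType) (P : pred nat) (M : nat) :
  0 < \prod_(0 <= p < M | prime p) (if P p then 1 - (p%:R)^-1 else 1) :> R.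
Proof.
apply: prodr_gt0 => p pp; case: ifP => // _.
by rewrite subr_gt0 invf_lt1 ?ltr1n ?ltr0n ?prime_gt1 ?prime_gt0.
Qed.

(** Only the Euler factor at p can change, and 1 - 1 / p >= 1 / 2. *)
Lemma totient_prime_power_mul (R : realType) (p j d : nat) : prime p -> (0 < d)%N ->
  (p ^ j * d)%N%:R / (totient (p ^ j * d))%:R <= 2 * (d%:R / (totient d)%:R) :> R.
Proof.
move=> pp d0.
have q0 : (0 < p ^ j * d)%N by rewrite muln_gt0 expn_gt0 prime_gt0.
set q := (p ^ j * d)%N in q0 *.
pose M := (q + p)%N.
have p0 := prime_gt0 pp.
have qM : (0 < q <= M)%N by rewrite q0 leq_addr.
have dM : (0 < d <= M)%N.
  by rewrite d0 (leq_trans _ (leq_addr _ _))// leq_pmull// expn_gt0 p0.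
have E1 := totient_ratioE R qM; have E2 := totient_ratioE R dM.
have h : (totient d)%:R / d%:R * 2^-1 <= (totient q)%:R / q%:R :> R.
  rewrite E1 E2.
  have -> : 2^-1 = \prod_(0 <= r < M.+1 | prime r) (if r == p then 2^-1 else 1) :> R.
    rewrite big_mkcond (bigD1_seq p) ?iota_uniq ?mem_index_iota ?ltnS ?leq_addl//=.
    by rewrite pp eqxx big1 ?mulr1// => r /negbTE ->; case: ifP.
  rewrite -big_split/=; apply: ler_prod => r pr.
  have r1 : (2 : R) <= r%:R by rewrite ler_nat prime_gt1.
  have ri : (r%:R : R)^-1 <= 2^-1 by rewrite lef_pV2 ?posrE//; lra.
  have r0 : 0 < (r%:R : R)^-1 by rewrite invr_gt0; lra.
  apply/andP; split.
    by apply: mulr_ge0; [case: ifP => _; lra | case: ifP => _; lra].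
  case rd: (r %| d)%N.
    rewrite /q (dvdn_mull _ rd); case: ifP => _; lra.
  case: (r =P p) => [_|/eqP rp]; first by case: ifP => _; lra.
  rewrite /q Gauss_dvdr ?rd ?mulr1//.
  by rewrite coprimeXr// prime_coprime// dvdn_prime2.
have td0 : (0 : R) < (totient d)%:R by rewrite ltr0n totient_gt0.
have tq0 : (0 : R) < (totient q)%:R by rewrite ltr0n totient_gt0.
have d0R : (0 : R) < d%:R by rewrite ltr0n.
have q0R : (0 : R) < q%:R by rewrite ltr0n.
rewrite -[leLHS]invf_div -[X in _ <= _ * X]invf_div -(invrK 2) -invfM.
by rewrite lef_pV2 ?posrE 1?mulrC// ?mulr_gt0 ?invr_gt0.
Qed.

(** The weight c / phi(c) summed with logarithmic density 1 / c. *)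
Definition coprime_recip_sum (R : realType) (N X : nat) : R :=
  \sum_(1 <= c < X.+1 | coprime c N) ((totient c)%:R)^-1.

(** The weight is the dependence on c of the bound in [card_fiber_pairs_ratio]. *)
Definition coprime_weight_sum (R : realType) (N X : nat) : R :=
  \sum_(1 <= c < X.+1 | coprime c N) c%:R / (totient c)%:R.

(* Weigh each term by ln X = ln c + ln (X / c): the second part is at most X / c, and
   ln c is the sum of ln p over the prime powers p ^ j dividing c, so that writing
   c = p ^ j * d and applying Chebyshev's bound to the inner sum gives O(X / d). *)
Lemma coprime_weight_sum_ln (R : realType) (N X : nat) : (0 < X)%N ->
  coprime_weight_sum R N X * ln X%:R <= 9 * X%:R * coprime_recip_sum R N X.
Proof.
move=> X0; have X0R : (0 : R) < X%:R by rewrite ltr0n.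
pose f c : R := if (0 < c)%N && coprime c N then c%:R / (totient c)%:R else 0.
have f0 c : 0 <= f c by rewrite /f; case: ifP => // _; rewrite divr_ge0.
have SE : coprime_weight_sum R N X = \sum_(c < X.+1) f c.
  rewrite /coprime_weight_sum big_mkcond/=.
  rewrite -(big_mkord xpredT f) [RHS]big_ltn//= {1}/f/= add0r.
  by rewrite big_nat_cond [RHS]big_nat_cond; apply: eq_bigr => c /andP[/andP[c1 _] _];
      rewrite /f c1.
have TE : coprime_recip_sum R N X = \sum_(c < X.+1) f c / c%:R.
  rewrite /coprime_recip_sum [LHS]big_mkcond/=.
  rewrite -(big_mkord xpredT (fun c => f c / c%:R)) [RHS]big_ltn//= {1}/f/= mul0r add0r.
  rewrite big_nat_cond [RHS]big_nat_cond; apply: eq_bigr => c /andP[/andP[c1 _] _]; rewrite /f c1/=.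
  case: ifP => _; rewrite ?mul0r// mulrAC divff ?div1r// pnatr_eq0 -lt0n//.
rewrite SE TE.
pose B := \sum_(c < X.+1) f c * ln (c%:R : R).
have step1 : (\sum_(c < X.+1) f c) * ln X%:R <= B + X%:R * \sum_(c < X.+1) f c / c%:R.
  rewrite /B mulr_suml mulr_sumr -big_split/=; apply: ler_sum => c _.
  have [c0|c0] := posnP c; first by rewrite c0 /f/= !mul0r mulr0 addr0.
  have c0R : (0 : R) < c%:R by rewrite ltr0n.
  have : ln (X%:R / c%:R) <= X%:R / c%:R - 1 :> R by apply: ln_le_subr1; rewrite divr_gt0.
  rewrite ln_div ?posrE// => h.
  rewrite mulrCA -mulrDr ler_wpM2l//; lra.
(* The 8 is 2 * 4: a factor 2 for passing from the weight of c to that of d, and the constant 4 of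
   Chebyshev's bound. The part ln (X / c) accounts for the remaining 1 of the 9. *)
suff step2 : B <= 8 * X%:R * \sum_(c < X.+1) f c / c%:R by lra.
have lnE c : (c < X.+1)%N -> f c * ln c%:R =
   \sum_(0 <= p < X.+1 | prime p) \sum_(1 <= j < X.+1) (f c * (p ^ j %| c)%N%:R) * ln p%:R.
  move=> cX; have [->|c0] := posnP c.
    by rewrite /f/= mul0r big1// => p _; rewrite big1// => j _; rewrite !mul0r.
  have cM : (0 < c <= X)%N by rewrite c0 -ltnS.
  rewrite (ln_nat_sum R cM) mulr_sumr; apply: eq_bigr => p pp.
  rewrite (logn_indic_sum pp cM) natr_sum mulr_suml mulr_sumr.
  by apply: eq_bigr => j _; rewrite mulrA.
rewrite /B (eq_bigr (fun c : 'I_X.+1 => \sum_(0 <= p < X.+1 | prime p)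
    \sum_(1 <= j < X.+1) (f c * (p ^ j %| c)%N%:R) * ln p%:R)); last first.
  by move=> c _; rewrite lnE.
rewrite exchange_big/=.
under eq_bigr do rewrite exchange_big/=.
(* Under c = p^j * d the range c <= X becomes p^j <= X %/ d, so the later sum over p and j is
   Chebyshev's function at X %/ d. *)
have inner p j : prime p -> \sum_(c < X.+1) f c * (p ^ j %| c)%N%:R * ln p%:R <=
    \sum_(d < X.+1) 2 * f d * ((0 < d) && (p ^ j <= X %/ d))%N%:R * ln p%:R.
  move=> pp; rewrite -!mulr_suml ler_wpM2r ?ln_nat_ge0//.
  have q0 : (0 < p ^ j)%N by rewrite expn_gt0 prime_gt0.
  apply: (@le_trans _ _ (\sum_(c < X.+1) \sum_(d < X.+1) ((0 < d) && (p ^ j * d == c))%N%:R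
      * (2 * f d))).
    apply: ler_sum => c _.
    have pos (d : 'I_X.+1) : 0 <= ((0 < d) && (p ^ j * d == c))%N%:R * (2
        * f d) by rewrite !mulr_ge0.
    case: (boolP (p ^ j %| c)%N) => [/dvdnP[d dE]|_]; last first.
      by rewrite mulr0; apply: sumr_ge0 => d _; apply: pos.
    rewrite mulr1; have [c0|c0] := posnP c.
      by rewrite c0 {1}/f/=; apply: sumr_ge0 => d' _; have := pos d'; rewrite c0.
    have d0 : (0 < d)%N by move: c0; rewrite dE muln_gt0 => /andP[].
    have dX : (d < X.+1)%N.
      by rewrite (leq_ltn_trans _ (ltn_ord c))// dE leq_pmulr.
    rewrite (bigD1 (Ordinal dX))//= d0 mulnC -dE eqxx/= mul1r -[leLHS]addr0 lerD//; last first.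
      by apply: sumr_ge0 => d' _; apply: pos.
    rewrite /f c0 d0/=; case: (boolP (coprime c N)) => cN; last first.
      by case: ifP => _; rewrite !mulr_ge0.
    rewrite (coprime_dvdl _ cN); last by rewrite dE dvdn_mulr.
    by rewrite dE mulnC totient_prime_power_mul.
  rewrite exchange_big/=; apply: ler_sum => d _.
  rewrite -mulr_suml mulrC ler_wpM2l ?mulr_ge0//.
  case d0: (0 < d)%N => /=; last by rewrite big1.
  rewrite leq_divRL//; have [h|h] := leqP (p ^ j * d)%N X.
    rewrite -ltnS in h.
    rewrite (bigD1 (Ordinal h))//= eqxx big1 ?addr0// => i.
    by rewrite -val_eqE/= eq_sym => /negbTE ->.
  rewrite big1// => i _; case: eqP => // E; move: h.
  by rewrite E ltnNge -ltnS ltn_ord.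
apply: (@le_trans _ _ (\sum_(0 <= p < X.+1 | prime p) \sum_(1 <= j < X.+1)
    \sum_(d < X.+1) 2 * f d * ((0 < d) && (p ^ j <= X %/ d))%N%:R * ln p%:R)).
  by apply: ler_sum => p pp; apply: ler_sum => j _; apply: inner.
under [leLHS]eq_bigr do rewrite exchange_big/=.
rewrite exchange_big/= mulr_sumr; apply: ler_sum => d _.
have [d0|d0] := posnP d.
  rewrite big1 ?d0 /f/= ?mul0r ?mulr0// => p _; rewrite big1// => j _.
  by rewrite !(mulr0, mul0r).
have dX : (0 < X %/ d <= X)%N.
  by rewrite divn_gt0// -ltnS ltn_ord/= leq_div.
have -> : \sum_(0 <= p < X.+1 | prime p) \sum_(1 <= j < X.+1)
    2 * f d * (true && (p ^ j <= X %/ d)%N)%:R * ln (p%:R : R) = 2 * f d * cheb_psi R (X %/ d).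
  rewrite (cheb_psiE R dX) mulr_sumr; apply: eq_bigr => p _; rewrite mulr_sumr.
  by apply: eq_bigr => j _; rewrite mulrA.
have d0R : (0 : R) < d%:R by rewrite ltr0n.
have : cheb_psi R (X %/ d) <= 4 * (X%:R / d%:R).
  apply: le_trans (cheb_psi_linear _ _) _; rewrite ler_wpM2l//.
  by rewrite ler_pdivlMr// -natrM ler_nat leq_trunc_div.
move=> h; apply: (@le_trans _ _ (2 * f d * (4 * (X%:R / d%:R)))).
  by rewrite ler_wpM2l// mulr_ge0.
by rewrite le_eqVlt; apply/orP; left; apply/eqP; ring.
Qed.

(** Every prime here has ln p >= K ln 2, so it suffices to bound the sum of ln p / p. Below [L] =
    2^h Mertens gives h ln 2 + 4. Above [L] one has 1 / p < 1 / L, and the logarithms of the primes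
    dividing N add up to at most ln N <= 4 L ln 2. Division by K ln 2 gives a bounded result because
    h <= 2 E K. *)
Lemma sum_large_prime_divisors (R : realType) (h E K X N : nat) :
  (0 < K)%N -> (h <= 2 * E * K)%N -> (0 < N)%N -> (N <= 2 ^ (2 ^ (h + 2)))%N ->
  (2 ^ K <= X)%N ->
  \sum_(0 <= p < N.+1 | [&& prime p, (p %| N)%N & (X < p)%N]) (p%:R)^-1 <= (2 * E + 20)%N%:R :> R.
Proof.
move=> K0 hE N0 NL KX.
have l2 := @ln_two_ge R; have l21 := @ln_two_le1 R.
set l := ln (2 : R) in l2 l21.
have KR : (1 : R) <= K%:R by rewrite ler1n.
pose L := (2 ^ h)%N.
have L0 : (0 < L)%N by rewrite expn_gt0.
have LR : (0 : R) < L%:R by rewrite ltr0n.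
have lnNle : ln (N%:R : R) <= 4 * L%:R * l.
  apply: (@le_trans _ _ (ln ((2 ^ (2 ^ (h + 2)))%N%:R : R))).
    by rewrite ler_ln ?posrE ?ltr0n ?expn_gt0// ler_nat.
  rewrite natrX lnXn// -/l -(mulr_natl l) expnD natrM -/L -[(2 ^ 2)%N]/4%N.
  by rewrite (mulrC L%:R).
have H : \sum_(0 <= p < N.+1 | [&& prime p, (p %| N)%N & (X < p)%N]) (p%:R)^-1 * (K%:R * l) <=
   \sum_(0 <= p < N.+1 | prime p && (p <= L)%N) ln p%:R / p%:R + (ln N%:R) / L%:R.
  have NN : (0 < N <= N)%N by rewrite N0/=.
  rewrite (ln_nat_sum R NN) mulr_suml.
  rewrite [leLHS]big_mkcond/= [X in _ <= X + _]big_mkcond/= [X in _ <= _ + X]big_mkcond/=.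
  rewrite -big_split/=; apply: ler_sum => p _.
  case: (boolP (prime p)) => /= pp; last by rewrite addr0.
  have p0 : (0 : R) < p%:R by rewrite ltr0n prime_gt0.
  have lp0 := ln_nat_ge0 R p.
  have t1 : 0 <= (if (p <= L)%N then ln (p%:R : R) / p%:R else 0).
    by case: ifP => // _; rewrite divr_ge0// ltW.
  have t2 : 0 <= (logn p N)%:R * ln (p%:R : R) / L%:R.
    by rewrite !mulr_ge0// invr_ge0 ltW.
  case: ifP => [/andP[pN Xp]|_]; last by rewrite addr_ge0.
  have Kl : K%:R * l <= ln (p%:R : R).
    rewrite /l mulr_natl -lnXn// ler_ln ?posrE ?exprn_gt0//.
    by rewrite -natrX ler_nat (leq_trans KX)// ltnW.
  have Kp : (p%:R)^-1 * (K%:R * l) <= ln (p%:R : R) / p%:R.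
    by rewrite mulrC ler_wpM2r// invr_ge0 ltW.
  apply: (le_trans Kp); case: (leqP p L) => [pL|Lp]; first by rewrite lerDl.
  rewrite add0r; have lg : (1 : R) <= (logn p N)%:R.
    by rewrite ler1n logn_gt0 mem_primes pp N0.
  apply: ler_pM => //.
    by rewrite ler_peMl.
  by rewrite lef_pV2 ?posrE// ler_nat ltnW.
have H2 : \sum_(0 <= p < N.+1 | prime p && (p <= L)%N) ln p%:R / p%:R <= h%:R * l + 4 :> R.
  have := @sum_ln_prime_div_le R L L0; rewrite [in ln _]/L natrX lnXn// -/l -(mulr_natl l).
  apply: le_trans; rewrite (big_nat_widen 0 L.+1 (N.+1 + L.+1))/= ?leq_addl//.
  rewrite [leRHS](big_cat_nat (n := N.+1))//= ?leq_addr//.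
  rewrite -[leLHS]addr0 lerD//; last first.
    by apply: sumr_ge0 => p _; rewrite divr_ge0// ln_nat_ge0.
have H3 : ln (N%:R : R) / L%:R <= 4.
  rewrite ler_pdivrMr//; apply: (le_trans lnNle).
  by rewrite -mulrA ler_wpM2l// ler_piMr// ltW.
rewrite -mulr_suml in H.
have hR : (h%:R : R) <= 2 * E%:R * K%:R by rewrite -!natrM ler_nat.
have Kl0 : 0 < K%:R * l by apply: mulr_gt0; lra.
rewrite -(ler_pM2r Kl0); apply: (le_trans H).
apply: (le_trans (lerD H2 H3)).
have hl : h%:R * l <= 2 * E%:R * K%:R * l by rewrite ler_wpM2r//; lra.
have Kl2 : 2^-1 <= K%:R * l by rewrite -[leLHS]mul1r ler_pM//; lra.
rewrite natrD natrM; nra.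
Qed.

Lemma sum_consecutive_recip_le (R : realType) (n : nat) :
  \sum_(0 <= p < n.+1 | prime p) (p%:R * (p%:R - 1))^-1 <= 1 :> R.
Proof.
suff H k : \sum_(0 <= p < k.+2 | prime p) (p%:R * (p%:R - 1))^-1 <= 1 - (k.+1%:R)^-1 :> R.
  case: n => [|n]; first by rewrite big_mkcond/= big_nat1/=.
  by apply: le_trans (H n) _; rewrite gerBl// invr_ge0.
elim: k => [|k IH]; first by rewrite big_mkcond/= big_ltn// big_nat1/= addr0 invr1 subrr.
rewrite big_mkcond big_nat_recr//= -big_mkcond/=.
have k0 : (0 : R) < k.+1%:R by rewrite ltr0n.
have e2 : k.+2%:R = k.+1%:R + 1 :> R by rewrite natr1.
apply: (@le_trans _ _ (1 - k.+1%:R^-1 + (k.+2%:R * (k.+2%:R - 1))^-1)).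
  apply: lerD => //; case: ifP => // _; rewrite invr_ge0 e2 addrK mulr_ge0//; lra.
rewrite le_eqVlt; apply/orP; left; apply/eqP; rewrite e2.
by field; rewrite !gt_eqF//; lra.
Qed.

(* Mertens' bound turns the Euler product for coprime_recip_sum into ln X * phi(N) / N, the
   primes above X contributing a bounded factor. *)
Lemma coprime_sums_le (R : realType) (E : nat) : exists2 C : R, 0 < C &
  forall h K X N, (0 < K)%N -> (h <= 2 * E * K)%N -> (0 < N)%N ->
    (N <= 2 ^ (2 ^ (h + 2)))%N -> (2 ^ K <= X)%N ->
  coprime_recip_sum R N X <= C * ln X%:R * ((totient N)%:R / N%:R) /\
  coprime_weight_sum R N X <= C * X%:R * ((totient N)%:R / N%:R).
Proof.
have [C4 HC4] := sum_inv_prime_le R.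
pose C3 : R := (2 * E + 20)%N%:R.
pose C := expR (C4 + 4 + C3).
have C0 : 0 < C by apply: expR_gt0.
exists (9 * C); first by rewrite mulr_gt0.
move=> h K X N K0 hE N0 NL KX.
have X2 : (2 <= X)%N by rewrite (leq_trans _ KX)// -{1}(expn1 2) leq_pexp2l.
have X0 : (0 < X)%N by apply: ltnW.
have lX0 : 0 < ln (X%:R : R) by apply: ln_nat_gt0.
set w : R := (totient N)%:R / N%:R.
have w0 : 0 < w by rewrite divr_gt0// ltr0n ?totient_gt0.
have rec : coprime_recip_sum R N X <= C * ln X%:R * w.
  apply: (le_trans (coprime_totient_sum_le _ _ N0)).
  pose Q : R := \sum_(0 <= p < X.+1 | prime p && (p %| N)%N) (p%:R)^-1.
  (* The term p / (p - 1)^2 exceeds 1 / p by at most 3 / (p (p - 1)), which sums to at most 3; the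
     primes dividing N leave Mertens' sum as [Q]. *)
  have s1 : \sum_(0 <= p < X.+1 | prime p && ~~ (p %| N)%N) p%:R / (p%:R - 1) ^+ 2
     <= ln (ln X%:R) + C4 - Q + 3 :> R.
    have H1 := HC4 X X2; have H2 := sum_consecutive_recip_le R X.
    have : \sum_(0 <= p < X.+1 | prime p && ~~ (p %| N)%N) p%:R / (p%:R - 1) ^+ 2 + Q
      <= \sum_(0 <= p < X.+1 | prime p) (p%:R)^-1 + 3 * \sum_(0
          <= p < X.+1 | prime p) (p%:R * (p%:R - 1))^-1 :> R.
      rewrite mulr_sumr -big_split/= /Q !big_mkcondr/= -big_split/=; apply: ler_sum => p pp.
      have p2 : (2 : R) <= p%:R by rewrite ler_nat prime_gt1.
      have h0 : 0 < (p%:R * (p%:R - 1))^-1 :> R by rewrite invr_gt0 mulr_gt0//; lra.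
      case: (p %| N)%N => /=; first by rewrite add0r lerDl mulr_ge0// ltW.
      rewrite addr0.
      have -> : p%:R / (p%:R - 1) ^+ 2 = p%:R^-1
          + 3 * (p%:R * (p%:R - 1))^-1 - (p%:R - 2) / (p%:R * (p%:R - 1) ^+ 2) :> R.
        by field; rewrite !gt_eqF//; lra.
      rewrite gerBl// divr_ge0//; first lra.
      by rewrite mulr_ge0 ?sqr_ge0//; lra.
    lra.
  (* The same [Q] bounds phi(N) / N from below, since -ln (1 - 1 / p) <= 1 / (p - 1) = 1 / p + 1 /
     (p (p - 1)). Here [C3] is for the primes above X and 1 for the corrections. [Q] cancels against
     [s1], leaving the exponent C4 + 4 + C3 of [C]. *)
  have s2 : expR (- (Q + C3 + 1)) <= w.
    pose M := (X + N)%N.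
    have NM : (0 < N <= M)%N by rewrite N0 leq_addl.
    rewrite /w (totient_ratioE R NM).
    have H2 := sum_consecutive_recip_le R M.
    have H3 := @sum_large_prime_divisors R h E K X N K0 hE N0 NL KX.
    apply: (@le_trans _ _ (expR (- \sum_(0 <= p < M.+1 | prime p && (p %| N)%N) (p%:R - 1)^-1))).
      rewrite ler_expR lerN2.
      apply: (@le_trans _ _ (Q + \sum_(0 <= p < N.+1 | [&& prime p,
          (p %| N)%N & (X < p)%N]) (p%:R)^-1 +
         \sum_(0 <= p < M.+1 | prime p) (p%:R * (p%:R - 1))^-1)); last first.
        by rewrite -/C3 in H3; lra.
      rewrite /Q (big_nat_widen 0 X.+1 M.+1)/= ?ltnS ?leq_addr//.
      rewrite (big_nat_widen 0 N.+1 M.+1)/= ?ltnS ?leq_addl//.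
      rewrite [X in _ <= X + _ + _]big_mkcond [X in _ <= _ + X + _]big_mkcond.
      rewrite [leLHS]big_mkcond [X in _ <= _ + X]big_mkcond/= -!big_split/=.
      apply: ler_sum => p _; rewrite !ltnS.
      case: (boolP (prime p)) => /= pp; last by rewrite !addr0.
      have p2 : (2 : R) <= p%:R by rewrite ler_nat prime_gt1.
      have h0 : 0 < (p%:R * (p%:R - 1))^-1 :> R by rewrite invr_gt0 mulr_gt0//; lra.
      case: (boolP (p %| N)%N) => pN /=; last by rewrite !add0r ltW.
      have -> : (p%:R - 1)^-1 = p%:R^-1 + (p%:R * (p%:R - 1))^-1 :> R.
        by field; rewrite !gt_eqF//; lra.
      rewrite (dvdn_leq N0 pN) andbT.
      by case: leqP => _ /=; rewrite ?addr0 ?add0r.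
    rewrite -sumrN expR_sum [leLHS]big_mkcond [leRHS]big_mkcond/=; apply: ler_prod => p _.
    case: (boolP (prime p)) => /= pp; last by rewrite lexx ler01.
    case: (boolP (p %| N)%N) => pN /=; last by rewrite lexx ler01.
    have p2 : (2 : R) <= p%:R by rewrite ler_nat prime_gt1.
    rewrite expR_ge0/= expRN.
    have p1 : 0 < (p%:R - 1 : R) by lra.
    have -> : 1 - p%:R^-1 = (1 + (p%:R - 1)^-1)^-1 :> R.
      by field; rewrite ?gt_eqF//; lra.
    rewrite lef_pV2 ?posrE ?expR_gt0//; first exact: expR_ge1Dx.
    by rewrite addr_gt0// invr_gt0.
  apply: (@le_trans _ _ (expR (ln (ln X%:R) + (C4 + 4 + C3) + (- (Q + C3 + 1))))).
    by rewrite ler_expR; lra.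
  rewrite expRD [X in X * _]expRD lnK ?posrE// -/C [ln _ * C]mulrC ler_wpM2l//.
  by rewrite mulr_ge0 ?ltW.
split.
  have D0 : 0 <= C * ln X%:R * w by apply: mulr_ge0; [apply: mulr_ge0|]; exact: ltW.
  have -> : 9 * C * ln X%:R * w = 9 * (C * ln X%:R * w) by rewrite !mulrA.
  apply: (le_trans rec); by rewrite ler_peMl ?ler1n.
have := coprime_weight_sum_ln R N X0 => H.
rewrite -(ler_pM2r lX0); apply: (le_trans H).
have X0R : (0 : R) <= 9 * X%:R by rewrite mulr_ge0.
apply: (le_trans (ler_wpM2l X0R rec)).
by rewrite le_eqVlt; apply/orP; left; apply/eqP; ring.
Qed.

(** * Counting pairs of reduced fractions at a given distance *)

(** Only the injectivity of the Chinese remainder map is used, which is enough for an upper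
    bound. *)
Lemma chinese_count_le (I : eqType) (s : seq I) (m : I -> nat) (good : I -> nat -> bool) :
  uniq s -> {in s &, forall i j, i != j -> coprime (m i) (m j)} ->
  (forall i t, good i (t %% m i)%N = good i t) -> {in s, forall i, 0 < m i}%N ->
  (count (fun t => all (fun i => good i t) s) (iota 0 (\prod_(i <- s) m i)) <=
   \prod_(i <- s) count (good i) (iota 0 (m i)))%N.
Proof.
move=> us co per m0; elim: s us co m0 => [|i s IH] /=; first by rewrite !big_nil.
case/andP=> nis us co m0; rewrite !big_cons.
set q := (\prod_(j <- s) m j)%N.
have q0 : (0 < q)%N.
  by rewrite /q big_seq; apply: prodn_cond_gt0 => j js; rewrite m0// in_cons js orbT.
have coq : coprime (m i) q.
  rewrite /q big_seq; apply: (big_ind (fun x => coprime (m i) x)) => [|x y cx cy|j js];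
      first exact: coprimen1.
    by rewrite coprimeMr cx.
  apply: (co i j); rewrite ?mem_head ?in_cons ?js ?orbT//.
  by apply: contraNneq nis => ->.
have {IH} IH : (count (fun t => all (fun i => good i t) s) (iota 0 q) <=
   \prod_(i <- s) count (good i) (iota 0 (m i)))%N.
  apply: IH => // [x y xs ys|x xs]; last by rewrite m0// in_cons xs orbT.
  by apply: co; rewrite in_cons ?xs ?ys orbT.
apply: leq_trans (leq_mul (leqnn _) IH).
have allper t : all (fun j => good j (t %% q)%N) s = all (fun j => good j t) s.
  apply: eq_in_all => j js; rewrite -(per j (t %% q)%N) modn_dvdm ?per//.
  by rewrite /q (big_rem j)//= dvdn_mulr.
rewrite -!size_filter -(size_allpairs (fun x y => (x, y))).
pose phi t := (t %% m i, t %% q)%N.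
rewrite -(size_map phi); apply: uniq_leq_size.
  rewrite map_inj_in_uniq ?filter_uniq ?iota_uniq// => x y.
  rewrite !mem_filter !mem_iota !add0n => /and3P[_ _ xl] /and3P[_ _ yl] [e1 e2].
  have : (x == y %[mod m i * q])%N by rewrite chinese_remainder// e1 e2 !eqxx.
  by rewrite !modn_small// => /eqP.
move=> x /mapP[t]; rewrite mem_filter => /andP[/andP[g1 g2] _] ->.
apply/allpairsP; exists (t %% m i, t %% q)%N; split=> //=.
  by rewrite mem_filter per g1 mem_iota/= add0n ltn_mod m0// mem_head.
by rewrite mem_filter allper g2 mem_iota/= add0n ltn_mod.
Qed.

Lemma count_periodic (P : pred nat) (q s : nat) :
  (forall t, P (t %% q)%N = P t) ->
  count P (iota 0 (s * q)) = (s * count P (iota 0 q))%N.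
Proof.
move=> per; elim: s => [|s IH]; first by rewrite !mul0n.
rewrite mulSn addnC iotaD count_cat IH add0n mulSn addnC; congr (_ + _)%N.
rewrite -[(s * q)%N]addn0 iotaDl count_map; apply: eq_in_count => t.
by rewrite /= -(per (s * q + t)%N) modnMDl per.
Qed.

Lemma linear_root_mod (p m a : nat) : prime p -> ~~ (p %| m)%N ->
  exists2 r, (r < p)%N & (p %| a + m * r)%N.
Proof.
move=> pp pm; have p0 := prime_gt0 pp.
have m0 : (0 < m)%N by case: m pm => //; rewrite dvdn0.
have : coprime m p by rewrite coprime_sym prime_coprime.
case: (egcdnP p m0) => u v uv _ /eqP g1.
exists ((u * (p - a %% p)) %% p)%N; first by rewrite ltn_mod.
rewrite /dvdn -modnDmr modnMmr modnDmr mulnA [(m * u)%N]mulnC uv g1 mulnDl mul1n.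
rewrite -mulnA mulnCA addnCA -modnDml modnMr add0n -modnDml subnKC ?modnn//.
by rewrite ltnW// ltn_mod.
Qed.

(** The pairs of reduced fractions with a / m - b / n = c / lcm(m, n). *)
Definition fiber_pairs (m n : nat) (c : int) : {set 'I_m * 'I_n} :=
  [set ab : 'I_m * 'I_n | [&& coprime ab.1 m, coprime ab.2 n &
    (ab.1%:Z * (n %/ gcdn m n)%:Z - ab.2%:Z * (m %/ gcdn m n)%:Z == c)]].

Lemma coprime_prime_dvd (p a b : nat) : prime p -> coprime a b -> (p %| a)%N -> (p %| b)%N -> False.
Proof.
move=> pp /eqP ab pa pb; have : (p %| gcdn a b)%N by rewrite dvdn_gcd pa pb.
by rewrite ab dvdn1 => /eqP p1; rewrite p1 in pp.
Qed.

Section fiber.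
Variables (m n : nat) (c : int).
Hypotheses (m0 : (0 < m)%N) (n0 : (0 < n)%N).
Let g := gcdn m n.
Let m' := (m %/ g)%N.
Let n' := (n %/ g)%N.

Let g0 : (0 < g)%N. Proof. by rewrite gcdn_gt0 m0. Qed.
Let mE : (m' * g)%N = m. Proof. by rewrite divnK// dvdn_gcdl. Qed.
Let nE : (n' * g)%N = n. Proof. by rewrite divnK// dvdn_gcdr. Qed.
Let m'0 : (0 < m')%N. Proof. by move: m0; rewrite -mE muln_gt0 => /andP[]. Qed.
Let n'0 : (0 < n')%N. Proof. by move: n0; rewrite -nE muln_gt0 => /andP[]. Qed.
Let com'n' : coprime m' n'.
Proof.
have : (gcdn m' n' * g = 1 * g)%N by rewrite muln_gcdl mE nE mul1n.
by move/eqP; rewrite eqn_pmul2r.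
Qed.

(** A prime dividing c and m' would divide a n', although a is prime to m and n' is prime to m'; the
    case of n' is symmetric. *)
Lemma fiber_pairs_coprime : (0 < #|fiber_pairs m n c|)%N -> coprime `|c|%N (m' * n').
Proof.
case/card_gt0P => -[a b]; rewrite inE/= => /and3P[am bn /eqP cE].
rewrite -/m' -/n' in cE.
rewrite /coprime -dvdn1; apply/negP => /negP; rewrite dvdn1 => g1.
have gg : (1 < gcdn `|c| (m' * n'))%N.
  rewrite ltn_neqAle eq_sym g1/= gcdn_gt0 orbC muln_gt0 m'0 n'0//.
have pp := pdiv_prime gg; set p := pdiv _ in pp.
have : (p %| gcdn `|c| (m' * n'))%N by apply: pdiv_dvd.
rewrite dvdn_gcd Euclid_dvdM// => /andP[pc /orP[pm'|pn']].
  have pa : (p %| a * n')%N.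
    have : (p%:Z %| a%:Z * n'%:Z)%Z.
      rewrite -(subrK (b%:Z * m'%:Z) (a%:Z * n'%:Z)) cE rpredD//.
      by rewrite dvdz_mull.
    by rewrite -PoszM.
  have pm : (p %| m)%N by rewrite -mE dvdn_mulr.
  move: pa; rewrite Euclid_dvdM// => /orP[pa|pn'].
    exact: (coprime_prime_dvd pp am pa pm).
  exact: (coprime_prime_dvd pp com'n' pm' pn').
have pb : (p %| b * m')%N.
  have : (p%:Z %| b%:Z * m'%:Z)%Z.
    have -> : b%:Z * m'%:Z = a%:Z * n'%:Z - c by rewrite -cE; ring.
    by rewrite rpredB// dvdz_mull.
  by rewrite -PoszM.
have pn : (p %| n)%N by rewrite -nE dvdn_mulr.
move: pb; rewrite Euclid_dvdM// => /orP[pb|pm'].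
  exact: (coprime_prime_dvd pp bn pb pn).
exact: (coprime_prime_dvd pp com'n' pm' pn').
Qed.

(** The number of classes t modulo p, for p dividing g, with p | a0 + m' t or p | b0 + n' t. One
    congruence has no root when p divides m' n', and the two roots coincide when p divides c. *)
Let rho p := if (p %| m' * n')%N || (p %| `|c|)%N then 1%N else 2%N.

(* The solutions form a coset of Z/g, and coprimality excludes rho(p) classes mod p | g. *)
Lemma card_fiber_pairs :
  (#|fiber_pairs m n c| * (\prod_(p <- primes g) p) <= g * \prod_(p <- primes g) (p - rho p))%N.
Proof.
have [->//|] := posnP #|fiber_pairs m n c|.
case/card_gt0P => -[a0 b0]; rewrite inE/= -/g -/m' -/n' => /and3P[am0 bn0 /eqP cE0].
pose good p t := ~~ (p %| a0 + m' * t)%N && ~~ (p %| b0 + n' * t)%N.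
(* The coordinate t in Z/g of a solution, given by (a, b) = (a0, b0) + t (m', n') modulo integer
   multiples of (m, n). *)
pose tt (ab : 'I_m * 'I_n) : nat := `|((ab.1%:Z - a0%:Z) %/ m'%:Z)%Z %% g%:Z|%Z%N.
have gz : (0 : int) < g%:Z by rewrite ltz_nat.
have m'z : (m'%:Z : int) != 0 by rewrite eqz_nat -lt0n.
have n'z : (n'%:Z : int) != 0 by rewrite eqz_nat -lt0n.
have ttP (ab : 'I_m * 'I_n) : ab \in fiber_pairs m n c -> exists s : int,
   [/\ ab.1%:Z = a0%:Z + m'%:Z * (tt ab)%:Z + m%:Z * s & ab.2%:Z = b0%:Z + n'%:Z * (tt ab)%:Z
       + n%:Z * s].
  case: ab => a b; rewrite inE/= -/g -/m' -/n' => /and3P[_ _ /eqP cE].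
  have eq1 : (a%:Z - a0%:Z) * n'%:Z = (b%:Z - b0%:Z) * m'%:Z by lia.
  have dv : (m'%:Z %| a%:Z - a0%:Z)%Z.
    have : (m'%:Z %| (a%:Z - a0%:Z) * n'%:Z)%Z by rewrite eq1 dvdz_mull.
    by rewrite Gauss_dvdzl// /coprimez /gcdz/= eqz_nat.
  set s := ((a%:Z - a0%:Z) %/ m'%:Z)%Z.
  have sE : a%:Z - a0%:Z = s * m'%:Z by rewrite /s divzK.
  have sE2 : b%:Z - b0%:Z = s * n'%:Z.
    apply: (mulIf m'z); rewrite -eq1 sE; ring.
  have tE : (tt (a, b))%:Z = (s %% g%:Z)%Z by rewrite /tt/= gez0_abs// modz_ge0 ?gt_eqF.
  exists (s %/ g%:Z)%Z; rewrite /= tE.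
  have sd := divz_eq s g%:Z.
  have e1 : m%:Z = m'%:Z * g%:Z by rewrite -PoszM mE.
  have e2 : n%:Z = n'%:Z * g%:Z by rewrite -PoszM nE.
  split.
    apply: (addIr (- a0%:Z)); rewrite sE e1 {1}sd; ring.
  apply: (addIr (- b0%:Z)); rewrite sE2 e2 {1}sd; ring.
have tl ab : (tt ab < g)%N.
  by rewrite -ltz_nat /tt gez0_abs ?modz_ge0 ?gt_eqF// ltz_pmod.
have dvdg p : p \in primes g -> [/\ prime p, (p %| m)%N, (p %| n)%N & (p %| g)%N].
  rewrite mem_primes => /and3P[pp _ pg]; split => //.
    by rewrite -mE dvdn_mull.
  by rewrite -nE dvdn_mull.
have cardle : (#|fiber_pairs m n c| <= count (fun t => all (fun p =>
    good p t) (primes g)) (iota 0 g))%N.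
  rewrite -size_filter cardE -(size_map tt); apply: uniq_leq_size.
    rewrite map_inj_in_uniq ?enum_uniq// => -[a b] [a' b']; rewrite !mem_enum => h1 h2 e.
    have [s [/= sa sb]] := ttP _ h1; have [s' [/= sa' sb']] := ttP _ h2.
    rewrite -e in sa' sb'.
    have := ltn_ord a; have := ltn_ord a'; have := ltn_ord b; have := ltn_ord b' => lb' lb la' la.
    have ss : s = s'.
      have : (a%:Z - a'%:Z) = m%:Z * (s - s') by rewrite sa sa'; ring.
      move=> h; have : `|m%:Z * (s - s')| < m%:Z by rewrite -h; lia.
      rewrite normrM ger0_norm// -{2}[m%:Z]mulr1 ltr_pM2l ?ltz_nat//; lia.
    congr pair; apply/val_inj => /=; apply/eqP; rewrite -eqz_nat; apply/eqP.
      by rewrite sa sa' ss.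
    by rewrite sb sb' ss.
  move=> t /mapP[ab]; rewrite mem_enum => abS ->.
  rewrite mem_filter mem_iota/= add0n tl andbT; apply/allP => p /dvdg[pp pm pn pg].
  have [s [sa sb]] := ttP _ abS.
  move: abS; case: ab sa sb => a b /= sa sb; rewrite inE/= => /and3P[am bn _].
  apply/andP; split; apply/negP => h.
    apply: (coprime_prime_dvd pp am _ pm).
    have : (p%:Z %| a%:Z)%Z by rewrite sa rpredD// dvdz_mulr.
    by [].
  apply: (coprime_prime_dvd pp bn _ pn).
  have : (p%:Z %| b%:Z)%Z by rewrite sb rpredD// dvdz_mulr.
  by [].
have goodper p t : good p (t %% p)%N = good p t.
  by rewrite /good /dvdn -!(modnDmr _ (_ * (t %% p))) !modnMmr !modnDmr.
(* The conditions are periodic modulo the radical q of g, so the count over Z/g is g / q times the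
   count over Z/q, where the primes separate. *)
set q := (\prod_(p <- primes g) p)%N.
have qg : (q %| g)%N.
  rewrite [X in (_ %| X)%N](prod_prime_decomp g0) prime_decompE big_map/= /q !big_seq.
  elim/big_ind2: _ => // [x y z u|p]; first exact: dvdn_mul.
  by rewrite -logn_gt0 => lp; rewrite -{1}(expn1 p) dvdn_exp2l.
have chin : (count (fun t => all (fun p => good p t) (primes g)) (iota 0 q) <=
   \prod_(p <- primes g) count (good p) (iota 0 p))%N.
  apply: (@chinese_count_le nat (primes g) id good (primes_uniq g)) => //.
    move=> i j /dvdg[pi _ _ _] /dvdg[pj _ _ _] ij.
    by rewrite prime_coprime// dvdn_prime2.
  by move=> i /dvdg[pi _ _ _]; apply: prime_gt0.
have local p : p \in primes g -> (count (good p) (iota 0 p) <= p - rho p)%N.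
  move=> /dvdg[pp pm pn pg]; have p0 := prime_gt0 pp.
  rewrite -[X in (_ <= X - _)%N](size_iota 0 p) -(count_predC (good p)).
  suff : (rho p <= count (predC (good p)) (iota 0 p))%N by lia.
  have bad s : uniq s -> {in s, forall r, (r < p)%N && ~~ good p r} ->
      (size s <= count (predC (good p)) (iota 0 p))%N.
    move=> us hs; rewrite -size_filter; apply: uniq_leq_size => // r /hs /andP[rp rg].
    by rewrite mem_filter /= rg mem_iota.
  rewrite /rho Euclid_dvdM//.
  have [pm'|pm'] := boolP (p %| m')%N.
    have pn' : ~~ (p %| n')%N.
      by apply/negP => pn'; apply: (coprime_prime_dvd pp com'n' pm' pn').
    have [r rp rb] := linear_root_mod b0 pp pn'.
    apply: (bad [:: r]) => // x; rewrite inE => /eqP ->.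
    by rewrite rp /good rb andbF.
  have [r rp rb] := linear_root_mod a0 pp pm'.
  have [pn'|pn'] := boolP (p %| n')%N.
    apply: (bad [:: r]) => // x; rewrite inE => /eqP ->.
    by rewrite rp /good rb.
  have [pc|pc] := boolP (p %| `|c|)%N.
    apply: (bad [:: r]) => // x; rewrite inE => /eqP ->.
    by rewrite rp /good rb.
  have [r2 rp2 rb2] := linear_root_mod b0 pp pn'.
  apply: (bad [:: r; r2]).
    rewrite /= andbT inE; apply: contra pc => /eqP rr; rewrite -rr in rb2.
    have : (p%:Z %| c)%Z; last by [].
    have -> : c = (a0 + m' * r)%N%:Z * n'%:Z - (b0 + n' * r)%N%:Z * m'%:Z.
      by rewrite -cE0 !PoszD !PoszM; ring.
    by rewrite rpredB// dvdz_mulr.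
  move=> x; rewrite !inE => /orP[] /eqP ->; rewrite ?rp ?rp2 /good ?rb ?rb2 ?andbF//.
have allper t : all (fun p => good p (t %% q)%N) (primes g) = all (fun p => good p t) (primes g).
  apply: eq_in_all => p pg; rewrite -(goodper p (t %% q)%N) modn_dvdm ?goodper//.
  by rewrite /q (big_rem p)//= dvdn_mulr.
have cntg : (count (fun t => all (fun p => good p t) (primes g)) (iota 0 g) =
    g %/ q * count (fun t => all (fun p => good p t) (primes g)) (iota 0 q))%N.
  by rewrite -(count_periodic _ allper) divnK.
rewrite cntg in cardle; apply: leq_trans (leq_mul cardle (leqnn q)) _.
rewrite mulnAC divnK// leq_mul//.
apply: (leq_trans chin); rewrite !big_seq.
by elim/big_ind2: _ => [|x y z u|p]; [by [] | exact: leq_mul | exact: local].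
Qed.

End fiber.

(** Compared prime by prime through Euler products. For p | g the two sides agree if p divides N or
    c, which cannot both happen, and otherwise 1 - 2 / p <= (1 - 1 / p)^2. For p not dividing g, p |
    N holds exactly when p divides one of m and n. *)
Lemma card_fiber_pairs_ratio (R : realType) (m n g N : nat) (c : int) :
  (0 < m)%N -> (0 < n)%N -> c != 0 ->
  g = gcdn m n -> N = ((m %/ g) * (n %/ g))%N ->
  #|fiber_pairs m n c|%:R * ((totient N)%:R / N%:R) * ((totient `|c|%N)%:R / (`|c|%N)%:R) <=
  (coprime `|c|%N N)%:R * g%:R * ((totient m)%:R / m%:R) * ((totient n)%:R / n%:R) :> R.
Proof.
move=> m0 n0 c0 gE NE.
have g0 : (0 < g)%N by rewrite gE gcdn_gt0 m0.
have mE : (m %/ g * g)%N = m by rewrite divnK// gE dvdn_gcdl.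
have nE : (n %/ g * g)%N = n by rewrite divnK// gE dvdn_gcdr.
have m'0 : (0 < m %/ g)%N by move: m0; rewrite -{1}mE muln_gt0 => /andP[].
have n'0 : (0 < n %/ g)%N by move: n0; rewrite -{1}nE muln_gt0 => /andP[].
have N0 : (0 < N)%N by rewrite NE muln_gt0 m'0.
have ac0 : (0 < `|c|)%N by rewrite absz_gt0.
have [S0|Sn0] := posnP #|fiber_pairs m n c|.
  by rewrite S0 !mul0r !mulr_ge0.
have cN := fiber_pairs_coprime m0 n0 Sn0.
rewrite -gE -NE in cN; rewrite cN mul1r.
have := card_fiber_pairs c m0 n0; rewrite -gE -NE.
set rho := fun p => if (p %| N)%N || (p %| `|c|)%N then 1%N else 2%N => card_le.
pose M := (m + n + N + `|c|)%N.
have gm : (g <= m)%N by rewrite dvdn_leq// gE dvdn_gcdl.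
have gM : (0 < g <= M)%N by rewrite g0 /M; lia.
have mM : (0 < m <= M)%N by rewrite m0 /M; lia.
have nM : (0 < n <= M)%N by rewrite n0 /M; lia.
have NM : (0 < N <= M)%N by rewrite N0 /M; lia.
have cM : (0 < `|c| <= M)%N by rewrite ac0 /M; lia.
have cardR : #|fiber_pairs m n c|%:R <=
    g%:R * \prod_(0 <= p < M.+1 | prime p) (if (p %| g)%N then 1 - (rho p)%:R / p%:R else 1) :> R.
  have -> : \prod_(0 <= p < M.+1 | prime p) (if (p %| g)%N then 1 - (rho p)%:R / p%:R else 1) =
     \prod_(p <- primes g) (1 - (rho p)%:R / p%:R) :> R.
    rewrite -big_mkcondr/= -big_filter; apply: perm_big; apply: uniq_perm.
    - by rewrite filter_uniq// iota_uniq.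
    - exact: primes_uniq.
    - move=> p; rewrite mem_filter mem_index_iota mem_primes g0/= ltnS.
      case pp: (prime p) => //=; case: (boolP (p %| g)%N) => //= /dvdn_leq h.
      by rewrite (leq_trans (h g0))//; case/andP: gM.
  have q0 : (0 : R) < (\prod_(p <- primes g) p)%N%:R.
    by rewrite ltr0n big_seq; apply: prodn_cond_gt0 => p; rewrite mem_primes => /andP[/prime_gt0].
  rewrite -(ler_pM2r q0) -natrM; move: card_le; rewrite -(ler_nat R) => /le_trans; apply.
  rewrite natrM -mulrA ler_wpM2l// !natr_prod -big_split/= le_eqVlt; apply/orP; left; apply/eqP.
  apply: eq_big_seq => p; rewrite mem_primes => /andP[pp _].
  have p0 : (p%:R : R) != 0 by rewrite pnatr_eq0 -lt0n prime_gt0.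
  have p1 := prime_gt1 pp.
  rewrite natrB; last by rewrite /rho; case: ifP => _ //; apply: prime_gt0.
  by rewrite mulrBl mul1r divfK.
rewrite (totient_ratioE R NM) (totient_ratioE R mM) (totient_ratioE R nM) (totient_ratioE R cM).
set PN := \prod_(_ <= _ < _ | _) _; set Pc := \prod_(_
    <= _ < _ | _) (if (_ %| `|c|)%N then _ else _).
have PN0 : 0 <= PN by apply/ltW/prod_ratio_pos.
have Pc0 : 0 <= Pc by apply/ltW/prod_ratio_pos.
apply: (le_trans (ler_wpM2r Pc0 (ler_wpM2r PN0 cardR))).
rewrite -!mulrA ler_wpM2l// /PN /Pc -!big_split/=; apply: ler_prod => p pp.
have p2 : (2 : R) <= p%:R by rewrite ler_nat prime_gt1.
set u := (p%:R : R)^-1.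
have u2 : u <= 2^-1 by rewrite lef_pV2 ?posrE//; lra.
have u0 : 0 < u by rewrite invr_gt0; lra.
have gdE : (p %| g)%N = (p %| m)%N && (p %| n)%N by rewrite gE dvdn_gcd.
have mor : (p %| m)%N = (p %| m %/ g)%N || (p %| g)%N by rewrite -{1}mE Euclid_dvdM.
have nor : (p %| n)%N = (p %| n %/ g)%N || (p %| g)%N by rewrite -{1}nE Euclid_dvdM.
have Nor : (p %| N)%N = (p %| m %/ g)%N || (p %| n %/ g)%N by rewrite NE Euclid_dvdM.
have Nc : (p %| N)%N -> (p %| `|c|)%N -> False.
  by move=> pN pc; apply: (coprime_prime_dvd pp cN pc pN).
move: gdE mor nor Nor Nc; rewrite /rho.
case: (p %| g)%N; case: (p %| m)%N; case: (p %| n)%N => //=;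
  case: (p %| N)%N; case: (p %| `|c|)%N => //=; case: (p %| m %/ g)%N; case: (p %| n %/ g)%N => //=;
  move=> _ _ _ _ Nc; try (by case: Nc); rewrite -?/u; apply/andP; split; nra.
Qed.

(** * Overlaps averaged over dyadic scales *)

Lemma dyadic_sum_lt_le (R : realType) (z : R) (K : nat) : 0 <= z ->
  \sum_(1 <= k < K.+1) 2 ^+ k * (2 ^+ k < z)%R%:R <= 2 * z.
Proof.
move=> z0; elim: K => [|K IH]; first by rewrite big_geq// mulr_ge0.
have [h|h] := ltP (2 ^+ K.+1) z; last first.
  by rewrite big_nat_recr//= ltNge h /= mulr0 addr0.
apply: (@le_trans _ _ (\sum_(1 <= k < K.+2) 2 ^+ k)).
  apply: ler_sum => k _; rewrite ler_piMr ?exprn_ge0//.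
  by case: (_ < _).
suff -> : \sum_(1 <= k < K.+2) (2 : R) ^+ k = 2 ^+ K.+2 - 2.
  by rewrite exprS; lra.
elim: K {IH h} => [|K IH]; first by rewrite big_nat1; lra.
by rewrite big_nat_recr//= IH !exprS; lra.
Qed.

(** A scale with Y / 2^k >= 2^K, called [big], costs at most C Y phi(N) / N by the count in a long
    range. At the other scales only j <= 2^K occur; for these k is summed before j, and the
    geometric sum 2 Y / j turns the weight into 2 Y / phi(j), whose sum is bounded by
    [coprime_sums_le] at X = 2^K. The two parts give 3 = 1 + 2. *)
Lemma multiscale_weight_le (R : realType) (E : nat) : exists2 C : R, 0 < C &
  forall h K N J (Y : R), (0 < K)%N -> (h <= 2 * E * K)%N -> (0 < N)%N ->
    (N <= 2 ^ (2 ^ (h + 2)))%N -> 0 <= Y ->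
  \sum_(1 <= j < J.+1 | coprime j N) (j%:R / (totient j)%:R) *
     \sum_(1 <= k < K.+1) 2 ^+ k * (j%:R * 2 ^+ k < Y)%R%:R <=
  C * K%:R * Y * ((totient N)%:R / N%:R).
Proof.
have [C C0 HC] := coprime_sums_le R E.
exists (3 * C); first by rewrite mulr_gt0.
move=> h K N J Y K0 hE N0 NL Y0.
set w := (totient N)%:R / N%:R; have w0 : 0 <= w by rewrite divr_ge0.
pose f j : R := j%:R / (totient j)%:R; have f0 j : 0 <= f j by rewrite divr_ge0.
pose big k := (2 ^+ K <= Y / 2 ^+ k)%R.
have e0 k : 0 < (2 : R) ^+ k by rewrite exprn_gt0.
apply: (@le_trans _ _
  (\sum_(1 <= k < K.+1 | big k) 2 ^+ k * \sum_(1
      <= j < J.+1 | coprime j N) f j * (j%:R * 2 ^+ k < Y)%R%:R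
   + \sum_(1 <= j < J.+1 | coprime j N && (j <= 2 ^ K)%N) f j * \sum_(1
       <= k < K.+1) 2 ^+ k * (j%:R * 2 ^+ k < Y)%R%:R)).
  under [X in _ <= X + _]eq_bigr do rewrite mulr_sumr.
  rewrite [X in _ <= X + _]exchange_big/= [X in _ <= _ + X]big_mkcondr/= -big_split/=.
  apply: ler_sum => j _; rewrite mulr_sumr.
  have [jK|jK] := leqP j (2 ^ K)%N.
    by rewrite -mulr_sumr lerDr sumr_ge0// => k _; rewrite !mulr_ge0// ltW.
  rewrite addr0 [leRHS]big_mkcond/=; apply: ler_sum => k _.
  case: ifPn => bk; first by rewrite mulrCA.
  rewrite (_ : (_ < _) = false) ?mulr0//; apply/negbTE; rewrite -leNgt.
  have : Y / 2 ^+ k < 2 ^+ K by rewrite ltNge.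
  rewrite ltr_pdivrMr// => /ltW/le_trans; apply; rewrite ler_pM2r//.
  by rewrite -natrX ler_nat ltnW.
have -> : 3 * C * K%:R * Y * w = K%:R * (C * Y * w) + 2 * Y * (C * K%:R * w) by ring.
apply: lerD.
  apply: (@le_trans _ _ (\sum_(1 <= k < K.+1) C * Y * w)); last first.
    by rewrite sumr_const_nat subn1 /= mulr_natl.
  rewrite big_mkcond/=; apply: ler_sum => k _; case: ifP => bk; last first.
    by rewrite !mulr_ge0// ltW.
  pose X := Num.truncn (Y / 2 ^+ k).
  have Yk0 : 0 <= Y / 2 ^+ k by rewrite divr_ge0// ltW.
  have XY : X%:R <= Y / 2 ^+ k by rewrite truncn_le.
  have KX : (2 ^ K <= X)%N by rewrite /X truncn_ge_nat// natrX.
  have [_ HS] := HC h K X N K0 hE N0 NL KX.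
  apply: (@le_trans _ _ (2 ^+ k * coprime_weight_sum R N X)).
    apply: ler_wpM2l; first exact: ltW.
    rewrite /coprime_weight_sum.
    apply: (@le_trans _ _ (\sum_(1 <= j < J.+1 | coprime j N && (j <= X)%N) f j)).
      rewrite big_mkcondr/=; apply: ler_sum => j _.
      case: ifPn => jX; first by rewrite ler_piMr//; case: (_ < _).
      rewrite (_ : (_ < _) = false) ?mulr0//; apply/negbTE; rewrite -leNgt.
      rewrite -ler_pdivrMr//; apply: ltW; move: jX; rewrite -ltnNge.
      by rewrite /X truncn_lt_nat.
    rewrite (big_nat_widen 1 X.+1 (J.+1 + X.+1))/= ?leq_addl//.
    rewrite [leRHS](big_cat_nat (n := J.+1))//= ?leq_addr//.
    by rewrite lerDl sumr_ge0.
  apply: (le_trans (ler_wpM2l (ltW (e0 k)) HS)).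
  rewrite mulrA; apply: ler_wpM2r => //; rewrite mulrCA; apply: ler_wpM2l; first exact: ltW.
  by rewrite mulrC -ler_pdivlMr.
have [HT _] := HC h K (2 ^ K)%N N K0 hE N0 NL (leqnn _).
apply: (@le_trans _ _ (2 * Y * coprime_recip_sum R N (2 ^ K))); last first.
  rewrite ler_wpM2l ?mulr_ge0//; apply: (le_trans HT).
  apply: ler_wpM2r => //; apply: ler_wpM2l; first exact: ltW.
  rewrite natrX lnXn// -(mulr_natr (ln 2)) ler_piMl//.
  exact: ln_two_le1.
rewrite /coprime_recip_sum mulr_sumr.
apply: (@le_trans _ _ (\sum_(1 <= j < J.+1 | coprime j N && (j
    <= 2 ^ K)%N) 2 * Y * (totient j)%:R^-1)).
  rewrite big_nat_cond [leRHS]big_nat_cond; apply: ler_sum => j /andP[/andP[j0 _] _].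
  have j0R : (0 : R) < j%:R by rewrite ltr0n.
  have t0R : (0 : R) < (totient j)%:R by rewrite ltr0n totient_gt0.
  have := @dyadic_sum_lt_le R (Y / j%:R) K (divr_ge0 Y0 (ltW j0R)).
  under eq_bigr do rewrite ltr_pdivlMr// [_ * j%:R]mulrC.
  move=> H; apply: (le_trans (ler_wpM2l (f0 j) H)).
  by rewrite /f le_eqVlt; apply/orP; left; apply/eqP; field; rewrite !gt_eqF.
rewrite (big_nat_widen 1 (2 ^ K).+1 (J.+1 + (2 ^ K).+1))/= ?leq_addl//.
rewrite [leRHS](big_cat_nat (n := J.+1))//= ?leq_addr//.
rewrite lerDl sumr_ge0// => j _; by rewrite !mulr_ge0// invr_ge0.
Qed.

Definition coprime_pair (m n : nat) (ab : 'I_m * 'I_n) : bool :=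
  coprime ab.1 m && coprime ab.2 n.

Definition cross_diff (m n : nat) (ab : 'I_m * 'I_n) : int :=
  ab.1%:Z * (n %/ gcdn m n)%:Z - ab.2%:Z * (m %/ gcdn m n)%:Z.

(** Pairs are grouped by the absolute value j of their cross difference; the factor 2 is for the two
    fibres over j and -j. *)
Lemma sum_cross_diff_le (R : realType) (m n g N : nat) (F : nat -> R) :
  (0 < m)%N -> (0 < n)%N -> (forall j, 0 <= F j) ->
  g = gcdn m n -> N = ((m %/ g) * (n %/ g))%N ->
  \sum_(ab : 'I_m * 'I_n | coprime_pair ab && (cross_diff ab != 0)) F `|cross_diff ab|%N <=
  2 * (g%:R * ((totient m)%:R / m%:R) * ((totient n)%:R / n%:R) / ((totient N)%:R / N%:R)) *
   \sum_(1 <= j < (m * n).+1 | coprime j N) j%:R / (totient j)%:R * F j.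
Proof.
move=> m0 n0 F0 gE NE.
set r0 := _ / (_ / N%:R).
have g0 : (0 < g)%N by rewrite gE gcdn_gt0 m0.
have m'0 : (0 < m %/ g)%N by rewrite divn_gt0// gE dvdn_leq// dvdn_gcdl.
have n'0 : (0 < n %/ g)%N by rewrite divn_gt0// gE dvdn_leq// dvdn_gcdr.
have N0 : (0 < N)%N by rewrite NE muln_gt0 m'0.
have cb (ab : 'I_m * 'I_n) : (`|cross_diff ab| < (m * n).+1)%N.
  case: ab => a b; rewrite /cross_diff/= -gE.
  have : (a * (n %/ g) <= m * n)%N by rewrite leq_mul ?leq_div// ltnW.
  have : (b * (m %/ g) <= m * n)%N by rewrite mulnC leq_mul ?leq_div// ltnW.
  lia.
pose p (ab : 'I_m * 'I_n) : 'I_(m * n).+1 := Ordinal (cb ab).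
rewrite (partition_big p (fun j => (0 < j)%N))/=; last first.
  by move=> ab /andP[_]; rewrite absz_gt0.
have fib (c : int) : c != 0 -> #|fiber_pairs m n c|%:R <=
    (coprime `|c|%N N)%:R * (r0 * (`|c|%N%:R / (totient `|c|%N)%:R)) :> R.
  move=> c0; have H := @card_fiber_pairs_ratio R m n g N c m0 n0 c0 gE NE.
  have ac0 : (0 < `|c|)%N by rewrite absz_gt0.
  have A0 : (0 : R) < (totient N)%:R / N%:R by rewrite divr_gt0 ?ltr0n ?totient_gt0.
  have B0 : (0 : R) < (totient `|c|)%:R / (`|c|%N)%:R by rewrite divr_gt0 ?ltr0n ?totient_gt0.
  rewrite -(ler_pM2r A0) -(ler_pM2r B0); apply: (le_trans H).
  rewrite /r0 le_eqVlt; apply/orP; left; apply/eqP.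
  have N0R : (N%:R : R) != 0 by rewrite pnatr_eq0 -lt0n.
  have tN0R : ((totient N)%:R : R) != 0 by rewrite pnatr_eq0 -lt0n totient_gt0.
  have c0R : ((`|c|%N)%:R : R) != 0 by rewrite pnatr_eq0 -lt0n.
  have tc0R : ((totient `|c|)%:R : R) != 0 by rewrite pnatr_eq0 -lt0n totient_gt0.
  have mR : (m%:R : R) != 0 by rewrite pnatr_eq0 -lt0n.
  have nR : (n%:R : R) != 0 by rewrite pnatr_eq0 -lt0n.
  by move: (coprime _ _)%:R => x; field; rewrite N0R tN0R c0R tc0R mR nR.
rewrite [in leRHS]big_mkcond -(big_mkord (fun j => 0 < j)%N (fun j =>
    \sum_(ab | coprime_pair ab && (cross_diff ab != 0) && (`|cross_diff ab|%N == j)) F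
    `|cross_diff ab|%N)) /=.
rewrite big_ltn_cond//= mulr_sumr big_nat_cond [leRHS]big_nat_cond.
rewrite (eq_bigl (fun j => (1 <= j < (m * n).+1)%N && true)); last first.
  by move=> j; case: j => //= j; rewrite andbT.
apply: ler_sum => j /andP[/andP[j0 _] _].
rewrite (eq_bigr (fun=> F j)); last by move=> ab /andP[_ /eqP ->].
rewrite sumr_const -[F j *+ _]mulr_natl.
have jz : j%:Z != 0 by rewrite eqz_nat -lt0n.
have fj := fib j%:Z jz; have := fib (- j%:Z); rewrite oppr_eq0 abszN => /(_ jz) fj'.
have cardle : (#|fun i : 'I_m * 'I_n => coprime_pair i && (cross_diff i != 0%R) && (`|cross_diff
    i| == j)|
    <= #|fiber_pairs m n j%:Z| + #|fiber_pairs m n (- j%:Z)|)%N.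
  apply: leq_trans (leq_card_setU _ _); apply: subset_leq_card; apply/fintype.subsetP => -[x y].
  rewrite !inE unfold_in => /andP[/andP[/andP[-> ->] _] /eqP <-] /=.
  rewrite -[X in X == _]/(cross_diff (x, y)) -[X in _ || (X == _)]/(cross_diff (x, y)).
  by case: (cross_diff _) => k; rewrite ?eqxx ?NegzE ?orbT//= abszN eqxx orbT.
move: cardle; rewrite -(ler_nat R) natrD => cardle.
apply: (@le_trans _ _ (2 * ((coprime j N)%:R * (r0 * (j%:R / (totient j)%:R))) * F j)).
  rewrite ler_wpM2r//; apply: (le_trans cardle); rewrite mulr2n mulrDl !mul1r.
  exact: lerD.
by case: ifP => _; rewrite ?mul1r ?mul0r ?mulr0 ?mul0r// !mulrA.
Qed.

(** A bound for the length of the intersection of the intervals with centres x, y and radii u, v: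
    the whole shorter interval is charged as soon as they meet. *)
Definition overlap (R : realType) (x u y v : R) : R :=
  if `|x - y| < u + v then 2 * Num.min u v else 0.

Lemma cross_diff_eq0 (m n : nat) (ab : 'I_m * 'I_n) : coprime_pair ab ->
  cross_diff ab = 0 -> m = n /\ (ab.1 = ab.2 :> nat).
Proof.
case: ab => a b /andP[/= am bn]; rewrite /cross_diff/= => H.
have m0 : (0 < m)%N by rewrite (leq_ltn_trans _ (ltn_ord a)).
have n0 : (0 < n)%N by rewrite (leq_ltn_trans _ (ltn_ord b)).
have g0 : (0 < gcdn m n)%N by rewrite gcdn_gt0 m0.
have E : (a * n = b * m)%N.
  have : (a * (n %/ gcdn m n) = b * (m %/ gcdn m n))%N by lia.
  move/(congr1 (muln^~ (gcdn m n))).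
  by rewrite -!mulnA !divnK ?dvdn_gcdl ?dvdn_gcdr.
have mn : (m %| n)%N.
  by rewrite -(@Gauss_dvdr _ a) 1?coprime_sym// E dvdn_mull.
have nm : (n %| m)%N.
  by rewrite -(@Gauss_dvdr _ b) 1?coprime_sym// -E dvdn_mull.
have mnE : m = n by apply/eqP; rewrite eqn_dvd mn.
split => //; apply/eqP; rewrite -(eqn_pmul2r n0) E; apply/eqP.
by congr (_ * _)%N.
Qed.

(** With u = pm / m and v = pn / n, two neighbourhoods at scale k meet only if their cross
    difference c satisfies |c| 2^k < Y, where [Y] = 2 max(u, v) lcm(m, n), and then they share at
    most 2 min(u, v) / 2^k. The product of min and max restores u v. The factor 4^k compensates the
    decrease of a product of two lengths, and the term with m = n collects the fractions meeting
    themselves, the only pairs with c = 0. *)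
Lemma multiscale_overlap_le (R : realType) (E : nat) : exists2 C : R, 0 < C &
  forall h K m n (pm pn : R), (0 < K)%N -> (h <= 2 * E * K)%N ->
    (0 < m <= 2 ^ (2 ^ h.+1))%N -> (0 < n <= 2 ^ (2 ^ h.+1))%N ->
    0 <= pm -> 0 <= pn ->
  \sum_(1 <= k < K.+1) 4 ^+ k * \sum_(ab : 'I_m * 'I_n | coprime_pair ab)
     overlap (ab.1%:R / m%:R) (pm / m%:R / 2 ^+ k) (ab.2%:R / n%:R) (pn / n%:R / 2 ^+ k) <=
  C * K%:R * (pm * (totient m)%:R / m%:R) * (pn * (totient n)%:R / n%:R) +
  (m == n)%:R * (2 * K%:R * 2 ^+ K * (pm * (totient m)%:R / m%:R)).
Proof.
have [C C0 HC] := multiscale_weight_le R E.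
exists (8 * C); first by rewrite mulr_gt0.
move=> h K m n pm pn K0 hE /andP[m0 mh] /andP[n0 nh] pm0 pn0.
set g := gcdn m n; set N := ((m %/ g) * (n %/ g))%N.
have g0 : (0 < g)%N by rewrite gcdn_gt0 m0.
have mE : (m %/ g * g)%N = m by rewrite divnK// dvdn_gcdl.
have nE : (n %/ g * g)%N = n by rewrite divnK// dvdn_gcdr.
have m'0 : (0 < m %/ g)%N by rewrite divn_gt0// dvdn_leq// dvdn_gcdl.
have n'0 : (0 < n %/ g)%N by rewrite divn_gt0// dvdn_leq// dvdn_gcdr.
have N0 : (0 < N)%N by rewrite muln_gt0 m'0.
have NL : (N <= 2 ^ (2 ^ (h + 2)))%N.
  have -> : (2 ^ (h + 2) = 2 ^ h.+1 + 2 ^ h.+1)%N by rewrite addn2 [in LHS]expnS mul2n addnn.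
  by rewrite expnD; apply: leq_mul; [apply: leq_trans mh|apply: leq_trans nh]; exact: leq_div.
have mR : (0 : R) < m%:R by rewrite ltr0n.
have nR : (0 : R) < n%:R by rewrite ltr0n.
have gR : (0 : R) < g%:R by rewrite ltr0n.
have NR : (0 : R) < N%:R by rewrite ltr0n.
have m'R : (0 : R) < (m %/ g)%N%:R by rewrite ltr0n.
have n'R : (0 : R) < (n %/ g)%N%:R by rewrite ltr0n.
have mEr : m%:R = (m %/ g)%N%:R * g%:R :> R by rewrite -natrM mE.
have nEr : n%:R = (n %/ g)%N%:R * g%:R :> R by rewrite -natrM nE.
have NEr : N%:R = (m %/ g)%N%:R * (n %/ g)%N%:R :> R by rewrite -natrM.
set u := pm / m%:R; set v := pn / n%:R.
have u0 : 0 <= u by rewrite divr_ge0// ltW.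
have v0 : 0 <= v by rewrite divr_ge0// ltW.
pose d := Num.min u v; pose D := Num.max u v.
have d0 : 0 <= d by rewrite /d le_min u0.
have D0 : 0 <= D by rewrite /D le_max u0.
have dD : d * D = u * v by rewrite /d /D; case: (leP u v) => _ //; rewrite mulrC.
have dE : d <= u by rewrite /d ge_min lexx.
have uvD : u + v <= 2 * D.
  by have : u <= D /\ v <= D; [rewrite /D !le_max !lexx orbT | case; lra].
pose Y := 2 * D * (g%:R * N%:R).
have Y0 : 0 <= Y by rewrite /Y !mulr_ge0// ltW.
have e0 k : 0 < (2 : R) ^+ k by rewrite exprn_gt0.
pose ind k (j : nat) : R := (j%:R * 2 ^+ k < Y)%R%:R.
have ind0 k j : 0 <= ind k j by rewrite /ind.
have ov_le k (ab : 'I_m * 'I_n) :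
    4 ^+ k * overlap (ab.1%:R / m%:R) (u / 2 ^+ k) (ab.2%:R / n%:R) (v / 2 ^+ k) <=
    2 * d * (2 ^+ k * ind k `|cross_diff ab|%N).
  rewrite /overlap; case: ifPn => [H|_]; last by rewrite mulr0 !mulr_ge0// ltW.
  have -> : Num.min (u / 2 ^+ k) (v / 2 ^+ k) = d / 2 ^+ k.
    by rewrite /d minr_pMl// invr_ge0 ltW.
  have -> : (4 : R) ^+ k = 2 ^+ k * 2 ^+ k by rewrite -exprMn; congr (_ ^+ _); lra.
  have -> : ind k `|cross_diff ab|%N = 1.
    rewrite /ind (_ : (_ < _) = true)//.
    have cR : (`|cross_diff ab|%N%:R : R) = `|ab.1%:R / m%:R - ab.2%:R / n%:R| * (g%:R * N%:R).
      rewrite -[in RHS](ger0_norm (ltW (mulr_gt0 gR NR))) -normrM natr_absz intr_norm.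
      congr (`| _ |); rewrite /cross_diff -/g rmorphB !rmorphM/= -!pmulrn mEr nEr ?NEr.
      by field; rewrite !gt_eqF.
    rewrite cR /Y mulrAC ltr_pM2r ?mulr_gt0// -ltr_pdivlMr//.
    by apply: (lt_le_trans H); rewrite -mulrDl ler_pM2r ?invr_gt0.
  rewrite mulr1 le_eqVlt; apply/orP; left; apply/eqP.
  by field; rewrite gt_eqF.
pose s := pm * (totient m)%:R / m%:R.
have s0 : 0 <= s by rewrite divr_ge0// ?mulr_ge0// ltW.
apply: (@le_trans _ _ (\sum_(1 <= k < K.+1) \sum_(ab : 'I_m * 'I_n | coprime_pair ab)
    2 * d * (2 ^+ k * ind k `|cross_diff ab|%N))).
  by apply: ler_sum => k _; rewrite mulr_sumr; apply: ler_sum => ab _; exact: ov_le.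
rewrite exchange_big/= (bigID (fun ab => cross_diff ab != 0))/=; apply: lerD; last first.
  under eq_bigl do rewrite negbK.
  have [mn|mn] := eqVneq m n; last first.
    by rewrite mul0r big1// => ab /andP[cp /eqP /(cross_diff_eq0 cp)[]] /eqP; rewrite (negbTE mn).
  rewrite mul1r.
  apply: (@le_trans _ _ (\sum_(ab : 'I_m * 'I_n | coprime_pair ab && (cross_diff ab == 0)) 2
      * u * (K%:R * 2 ^+ K))).
    apply: ler_sum => ab _; apply: (@le_trans _ _ (\sum_(1 <= k < K.+1) 2 * u * 2 ^+ K)).
      rewrite big_nat_cond [leRHS]big_nat_cond; apply: ler_sum => k /andP[/andP[_ kK] _].
      apply: ler_pM; [by rewrite mulr_ge0|by rewrite mulr_ge0// ltW|by rewrite ler_pM2l|].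
      apply: (@le_trans _ _ (2 ^+ k)).
        apply: ler_piMr; first exact: ltW.
        by rewrite /ind; case: (_ < _); rewrite ?ler01 ?lexx.
      by rewrite ler_weXn2l// ler1n.
    by rewrite sumr_const_nat subn1/= -[_ *+ K]mulr_natl mulrCA.
  rewrite sumr_const -[_ *+ #|_|]mulr_natl.
  have cl : (#|fun ab : 'I_m * 'I_n => coprime_pair ab && (cross_diff ab == 0%R)| <= totient m)%N.
    rewrite totient_count_coprime big_mkord.
    have -> : (\sum_(i < m) coprime m i = #|[pred i : 'I_m | coprime m i]|)%N.
      by rewrite -sum1_card [RHS]big_mkcond/=; apply: eq_bigr => i _; rewrite inE; case: coprime.
    rewrite -(cardsE (fun ab : 'I_m * 'I_n => coprime_pair ab && (cross_diff ab == 0%R))).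
    rewrite -(@card_in_imset _ _ fst); last first.
      move=> [a b] [a' b'] /=; rewrite !inE !unfold_in => /andP[c1 /eqP d1] /andP[c2 /eqP d2] aa.
      have [_ /= e1] := cross_diff_eq0 c1 d1; have [_ /= e2] := cross_diff_eq0 c2 d2.
      by rewrite aa; congr pair; apply/val_inj; rewrite /= -e1 -e2 aa.
    apply: subset_leq_card; apply/fintype.subsetP => i /imsetP[[a b]].
    rewrite !inE unfold_in => /andP[/andP[/= c1 _] _] ->.
    by rewrite coprime_sym.
  move: cl; rewrite -(ler_nat R) => cl.
  have X0 : 0 <= 2 * u * (K%:R * 2 ^+ K) by rewrite !mulr_ge0// ltW.
  apply: (le_trans (ler_wpM2r X0 cl)); rewrite -/s /s /u le_eqVlt; apply/orP; left; apply/eqP.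
  by field; rewrite gt_eqF.
under eq_bigr do rewrite -mulr_sumr.
rewrite -mulr_sumr.
have F0 j : 0 <= \sum_(1 <= k < K.+1) 2 ^+ k * ind k j.
  by apply: sumr_ge0 => k _; rewrite mulr_ge0// ltW.
have H1 := @sum_cross_diff_le R m n g N _ m0 n0 F0 (erefl _) (erefl _).
have H2 := HC h K N (m * n)%N Y K0 hE N0 NL Y0.
have d20 : 0 <= 2 * d by rewrite mulr_ge0.
apply: (le_trans (ler_wpM2l d20 H1)).
set r0 := g%:R * _ * _ / _.
have r00 : 0 <= 2 * r0.
  by rewrite /r0 !mulr_ge0 ?invr_ge0 ?divr_ge0 ?mulr_ge0// ltW.
apply: (le_trans (ler_wpM2l d20 (ler_wpM2l r00 H2))).
rewrite le_eqVlt; apply/orP; left; apply/eqP.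
rewrite /r0 /Y.
have tN0 : ((totient N)%:R : R) != 0 by rewrite pnatr_eq0 -lt0n totient_gt0.
transitivity (8 * C * K%:R * (d * D) * (g%:R * g%:R * N%:R) * ((totient m)%:R / m%:R)
    * ((totient n)%:R / n%:R)).
  by field; rewrite tN0 !gt_eqF.
(* One factor g comes from the size of the fibres, the other from lcm(m, n) = g N. *)
have -> : g%:R * g%:R * N%:R = m%:R * n%:R :> R by rewrite mEr nEr NEr; ring.
by rewrite dD /u /v; field; rewrite !gt_eqF.
Qed.

(** * Measure of a block of neighbourhoods *)

(* With s = #{i | x \in A i}, the pointwise inequality 2 t s <= s^2 + t^2 1_U is integrated
   for the optimal t = C * L. *)
Lemma chung_erdos d (T : measurableType d) (R : realType) (mu : {measure set T -> \bar R})
    (I : finType) (P : pred I) (A : I -> set T) (l : I -> R) (q : I -> I -> R) (C : R) :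
  (forall i, measurable (A i)) ->
  (forall i, P i -> mu (A i) = (l i)%:E) -> (forall i, 0 <= l i) ->
  (forall i j, P i -> P j -> (mu (A i `&` A j) <= (q i j)%:E)%E) ->
  0 < C -> 0 < \sum_(i | P i) l i ->
  \sum_(i | P i) \sum_(j | P j) q i j <= C * (\sum_(i | P i) l i) ^+ 2 ->
  (C^-1%:E <= mu (\bigcup_(i in [set i | P i]) A i))%E.
Proof.
move=> mA lE l0 qE C0 L0 QC.
set U := \bigcup_(i in _) _; set L := \sum_(i | P i) l i in L0 QC *.
have mU : measurable U by apply: fin_bigcup_measurable => // i _.
have [->|Ufin] := eqVneq (mu U) +oo%E; first by rewrite leey.
pose t := C * L; have t0 : 0 < t by rewrite mulr_gt0.
have mind (B : set T) : measurable B -> measurable_fun setT (EFin \o (\1_B : T -> R)).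
  by move=> mB; apply/measurable_EFinP; exact: measurable_indic.
have mindc (B : set T) (c : R) : measurable B ->
    measurable_fun setT (EFin \o (fun x => c * \1_B x)).
  move=> mB; apply/measurable_EFinP; apply: measurable_funM => //; exact: measurable_indic.
have intc (B : set T) (c : R) : measurable B -> 0 <= c ->
    (\int[mu]_x (c * \1_B x)%:E = c%:E * mu B)%E.
  move=> mB c0; under eq_integral do rewrite EFinM.
  rewrite ge0_integralZl//; last exact: mind.
  by rewrite integral_indic// setIT.
have ind0 (B : set T) x : 0 <= \1_B x :> R by rewrite indicE.
have lhs : (\int[mu]_x (\sum_(i <- enum P) (2 * t * \1_(A i) x)%:E) = (2 * t * L)%:E)%E.
  rewrite ge0_integral_sum//; last 2 first.
  - by move=> i; exact: mindc.
  - by move=> i x _; rewrite lee_fin !mulr_ge0// ltW.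
  rewrite /L mulr_sumr -sumEFin -[RHS]big_enum/= big_seq [RHS]big_seq; apply: eq_bigr => i.
  rewrite mem_enum => Pi; rewrite intc// ?mulr_ge0 ?ltW//.
  by rewrite lE// EFinM.
have rhs : (\int[mu]_x (\sum_(i <- enum P) \sum_(j <- enum P) (\1_(A i `&` A j) x)%:E
    + (t ^+ 2 * \1_U x)%:E)
    <= (C * L ^+ 2)%:E + (t ^+ 2)%:E * mu U)%E.
  rewrite ge0_integralD//=; last 4 first.
  - by move=> x _; apply: sume_ge0 => i _; apply: sume_ge0 => j _; rewrite lee_fin.
  - by apply: emeasurable_sum => i; apply: emeasurable_sum => j; apply: mind; exact: measurableI.
  - by move=> x _; rewrite lee_fin mulr_ge0// sqr_ge0.
  - exact: mindc.
  rewrite intc ?sqr_ge0//; apply: leeD => //.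
  rewrite ge0_integral_sum//; last 2 first.
  - by move=> i; apply: emeasurable_sum => j; apply: mind; exact: measurableI.
  - by move=> i x _; apply: sume_ge0 => j _; rewrite lee_fin.
  apply: (@le_trans _ _ (\sum_(i | P i) \sum_(j | P j) q i j)%:E); last by rewrite lee_fin.
  rewrite -sumEFin -[leRHS]big_enum/= big_seq [leRHS]big_seq; apply: lee_sum => i.
  rewrite mem_enum => Pi; rewrite ge0_integral_sum//; last first.
    by move=> j; apply: mind; exact: measurableI.
  rewrite -sumEFin -[leRHS]big_enum/= big_seq [leRHS]big_seq; apply: lee_sum => j.
  rewrite mem_enum => Pj; rewrite integral_indic ?setIT//; last exact: measurableI.
  exact: qE.
have key : ((2 * t * L)%:E <= (C * L ^+ 2)%:E + (t ^+ 2)%:E * mu U)%E.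
  rewrite -lhs; apply: le_trans rhs; apply: ge0_le_integral => //.
  - by move=> x _; apply: sume_ge0 => i _; rewrite lee_fin !mulr_ge0// ltW.
  - by apply: emeasurable_sum => i; exact: mindc.
  - apply: emeasurable_funD; last exact: mindc.
    by apply: emeasurable_sum => i; apply: emeasurable_sum => j; apply: mind; exact: measurableI.
  move=> x _; pose s : R := \sum_(i <- enum P) \1_(A i) x.
  have -> : (\sum_(i <- enum P) (2 * t * \1_(A i) x)%:E = (2 * t * s)%:E)%E.
    by rewrite sumEFin -mulr_sumr.
  have -> : (\sum_(i <- enum P) \sum_(j <- enum P) (\1_(A i `&` A j) x)%:E = (s * s)%:E)%E.
    rewrite /s mulr_suml -sumEFin; apply: eq_bigr => i _; rewrite mulr_sumr sumEFin.
    by congr EFin; apply: eq_bigr => j _; rewrite indicI.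
  rewrite -EFinD lee_fin.
  have [xU|xU] := pselect (U x).
    rewrite indicE mem_set// mulr1; have := sqr_ge0 (s - t); rewrite sqrrB expr2; lra.
  have -> : s = 0.
    rewrite /s big_seq big1// => i; rewrite mem_enum => Pi.
    by rewrite indicE memNset// => Aix; apply: xU; exists i.
  by rewrite !mulr0 add0r mulr_ge0// sqr_ge0.
have mUf : mu U \is a fin_num by rewrite ge0_fin_numE// ltey.
move: key; rewrite -(fineK mUf) -EFinM -EFinD !lee_fin => key.
set m := fine _ in key *.
have : C * L ^+ 2 <= (C * L) ^+ 2 * m by rewrite /t in key; lra.
have -> : (C * L) ^+ 2 * m = (C * L ^+ 2) * (C * m) by ring.
rewrite -[X in X <= _]mulr1 ler_pM2l ?mulr_gt0 ?exprn_gt0// => h.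
by rewrite -ler_pdivrMl// in h; rewrite -[C^-1]mulr1.
Qed.

(** * Lengths, affine maps and sums over fractions *)

Lemma lebesgue_measure_itvoo_center (R : realType) (x u : R) : 0 <= u ->
  lebesgue_measure (`]x - u, x + u[%classic : set R) = (2 * u)%:E.
Proof.
move=> u0; rewrite lebesgue_measure_itv/= lte_fin.
case: ltP => h; first by rewrite -EFinB; congr EFin; lra.
by congr EFin; lra.
Qed.


(** By uniqueness of Lebesgue measure: a times its pushforward agrees with it on half-open
    intervals. *)
Lemma lebesgue_measure_affine (R : realType) (a b : R) (A : set R) : 0 < a -> measurable A ->
  lebesgue_measure A = (a%:E * lebesgue_measure ((fun x : R => (a * x + b)%R) @^-1` A))%E.
Proof.
move=> a0 mA; pose f : R -> measurableTypeR R := fun x => a * x + b.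
have mf : measurable_fun setT f.
  by apply: measurable_funD => //; apply: measurable_funM.
pose r : {nonneg R} := NngNum (ltW a0).
pose m1 : {measure set (measurableTypeR R) -> \bar R} :=
  measure_function_pushforward__canonical__measure_function_Measure lebesgue_measure mf.
have pushE X : ocitv X -> lebesgue_measure X = mscale r m1 X.
  move=> [[x y]] _ <-.
  rewrite /mscale /= /pushforward/=.
  pose J : set R := `](x - b) / a, (y - b) / a]%classic.
  transitivity (a%:E * lebesgue_measure J)%E; last first.
    congr (_ * lebesgue_measure _)%E; apply/esym.
    apply/seteqP; split => z /=; rewrite /J/= !in_itv/= /f.
      by move=> /andP[xz zy]; rewrite ltr_pdivrMr// ler_pdivlMr// ltrBlDr lerBrDr mulrC xz.
    by rewrite ltr_pdivrMr// ler_pdivlMr// ltrBlDr lerBrDr mulrC.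
  rewrite !lebesgue_measure_itv/= !lte_fin ltr_pM2r ?invr_gt0// ltrD2r.
  case: ifP => _; last by rewrite mule0.
  by rewrite -!EFinB -EFinM; congr EFin; field; rewrite gt_eqF//.
exact: (@lebesgue_measure_unique R (mscale r m1) pushE A mA).
Qed.

Lemma set_interval_lebesgue_le (R : realType) (A : set R) (x u : R) : measurable A -> 0 <= u ->
  A `<=` `]x - u, x + u[%classic -> (lebesgue_measure A <= (2 * u)%:E)%E.
Proof.
move=> mA u0 AB; have := @lebesgue_measure_itv R `]x - u, x + u[; rewrite /= lte_fin.
move=> E; apply: (@le_trans _ _ (lebesgue_measure (`]x - u, x + u[%classic : set R))).
  by apply: le_measure => //; rewrite inE.
rewrite E; case: ifP => _; last by rewrite lee_fin mulr_ge0.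
by rewrite -EFinB lee_fin; lra.
Qed.

Lemma lebesgue_measure_overlap (R : realType) (x u y v : R) : 0 <= u -> 0 <= v ->
  (lebesgue_measure (`](x - u)%R, (x + u)%R[ `&` `](y - v)%R,
      (y + v)%R[ : set R) <= (overlap x u y v)%:E)%E.
Proof.
move=> u0 v0; have mI : measurable (`]x - u, x + u[ `&` `]y - v, y + v[ : set R).
  exact: measurableI.
rewrite /overlap; case: ltP => h.
  rewrite /Num.min; case: ifP => _.
    by apply: (@set_interval_lebesgue_le R _ x) => // z [].
  by apply: (@set_interval_lebesgue_le R _ y) => // z [].
rewrite (_ : _ `&` _ = set0) ?measure0//; apply/seteqP; split => // z [] /=.
rewrite !in_itv/= => /andP[h1 h2] /andP[h3 h4].
by move: h; rewrite leNgt ltr_norml => /negP; apply; apply/andP; split; lra.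
Qed.

Lemma exists_le_average (R : realType) (K : nat) (F : nat -> R) (B : R) : (0 < K)%N ->
  \sum_(1 <= k < K.+1) F k <= K%:R * B -> exists2 k, (1 <= k <= K)%N & F k <= B.
Proof.
move=> K0 H; apply: contrapT => no; move: H; apply/negP; rewrite -ltNge.
have -> : K%:R * B = \sum_(1 <= k < K.+1) B by rewrite sumr_const_nat subn1/= mulr_natl.
apply: ltr_sum_nat => // k kK; rewrite ltNge; apply/negP => h; apply: no.
by exists k.
Qed.

(** [chung_erdos] takes a single finite index type, so the fractions a / n with a < n < M are
    indexed by dependent pairs. *)
Lemma sum_tagged (R : realType) (M lo : nat) (G : nat -> nat -> R) :
  \sum_(p : {i : 'I_M & 'I_i} | (lo <= tag p)%N && coprime (tagged p) (tag p)) G (tag p) (tagged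
      p) =
  \sum_(lo <= n < M) \sum_(a < n | coprime a n) G n a.
Proof.
rewrite big_geq_mkord.
by rewrite (sig_big_dep (fun n : 'I_M => lo <= n)%N (fun (n : 'I_M) (a : 'I_n) => coprime a n)
  (fun (n : 'I_M) (a : 'I_n) => G n a)).
Qed.

Lemma sum_coprime_const (R : realType) (n : nat) (x : R) :
  \sum_(a < n | coprime a n) x = (totient n)%:R * x.
Proof.
rewrite sumr_const -[_ *+ _]mulr_natl; congr (_%:R * _).
rewrite totient_count_coprime big_mkord -sum1_card [LHS]big_mkcond/=.
by apply: eq_bigr => i _; rewrite unfold_in -[eqn _ _]/(coprime i n) coprime_sym; case: coprime.
Qed.

(** These neighbourhoods stay on the line, with centres in [0, 1) and no folding modulo 1, so that
    the overlaps are those of plain intervals. *)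
Definition reduced_nbhd (R : realType) (psi : nat -> R) (n : nat) : set R :=
  \bigcup_(a in [set a | (a < n)%N && coprime a n])
     `](a%:R - psi n) / n%:R, (a%:R + psi n) / n%:R[%classic.

(** With S the mass of the block, the average over k of the overlap sums [Q k], normalised by 4^k,
    is at most (C + 2) S^2; the 2 is for the diagonal, where 2^K S <= S^2 by the assumption on the
    mass. At a scale k no worse than the average the lengths add up to 2 S / 2^k, whose square is 4
    S^2 / 4^k, hence the quotient (C + 2) / 4. Shrinking radii by 2^k only shrinks the union. *)
Lemma block_measure_ge (R : realType) (E : nat) : exists2 c : R, 0 < c &
  forall h K (psi : nat -> R), (0 < K)%N -> (h <= 2 * E * K)%N ->
    (forall n, (1 <= n)%N -> 0 <= psi n) ->
    2 ^+ K <= \sum_(2 ^ (2 ^ h) <= n < 2 ^ (2 ^ h.+1)) psi n * (totient n)%:R / n%:R ->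
  (c%:E <= lebesgue_measure
     (\bigcup_(n in [set n | (2 ^ (2 ^ h) <= n < 2 ^ (2 ^ h.+1))%N]) reduced_nbhd psi n))%E.
Proof.
have [C C0 HC] := multiscale_overlap_le R E.
exists (((C + 2) / 4)^-1); first by rewrite invr_gt0 divr_gt0//; lra.
move=> h K psi K0 hE psi0.
set lo := (2 ^ (2 ^ h))%N; set M := (2 ^ (2 ^ h.+1))%N.
set S := \sum_(_ <= _ < _) _ => SK.
have lo0 : (0 < lo)%N by rewrite expn_gt0.
have S0 : 0 < S by apply: lt_le_trans SK; rewrite exprn_gt0.
pose s n : R := psi n * (totient n)%:R / n%:R.
have s0 n : (0 < n)%N -> 0 <= s n by move=> n0; rewrite divr_ge0// mulr_ge0// psi0.
pose I := {i : 'I_M & 'I_i}.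
pose P (p : I) := (lo <= tag p)%N && coprime (tagged p) (tag p).
pose rad k n : R := psi n / n%:R / 2 ^+ k.
have e0 k : 0 < (2 : R) ^+ k by rewrite exprn_gt0.
have rad0 k n : (0 < n)%N -> 0 <= rad k n by move=> n0; rewrite !divr_ge0// ?psi0// ltW.
pose cen (p : I) : R := (tagged p)%:R / (tag p)%:R.
pose A k (p : I) : set R := `]cen p - rad k (tag p), cen p + rad k (tag p)[%classic.
pose ov k n a m b : R := overlap (a%:R / n%:R) (rad k n) (b%:R / m%:R) (rad k m).
pose Q k : R := \sum_(p | P p) \sum_(p' | P p') ov k (tag p) (tagged p) (tag p') (tagged p').
have tag0 (p : I) : (0 < tag p)%N by case: p => i j; rewrite /= (leq_ltn_trans _ (ltn_ord j)).
have QE k : Q k = \sum_(lo <= n < M) \sum_(lo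
    <= m < M) \sum_(ab : 'I_n * 'I_m | coprime_pair ab) ov k n ab.1 m ab.2.
  rewrite /Q.
  under eq_bigr do rewrite (sum_tagged M lo (fun m b => ov k _ _ m b)).
  rewrite (sum_tagged M lo (fun n a => \sum_(lo <= m < M) \sum_(b < m | coprime b m) ov k n a m b)).
  apply: eq_bigr => n _; rewrite exchange_big/=; apply: eq_bigr => m _.
  by rewrite pair_big_dep/=.
have Qsum : \sum_(1 <= k < K.+1) 4 ^+ k * Q k <= K%:R * ((C + 2) * S ^+ 2).
  under eq_bigr do rewrite QE mulr_sumr.
  rewrite exchange_big/=.
  have : \sum_(lo <= n < M) \sum_(1 <= k < K.+1) 4 ^+ k * \sum_(lo
      <= m < M) \sum_(ab : 'I_n * 'I_m | coprime_pair ab) ov k n ab.1 m ab.2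
     <= \sum_(lo <= n < M) (C * K%:R * s n * S + 2 * K%:R * 2 ^+ K * s n).
    rewrite big_nat_cond [leRHS]big_nat_cond; apply: ler_sum => n /andP[/andP[ln nM] _].
    under eq_bigr do rewrite mulr_sumr.
    rewrite exchange_big/=.
    have n0 := leq_trans lo0 ln.
    apply: (@le_trans _ _ (\sum_(lo <= m < M) (C * K%:R * s n * s m
        + (n == m)%:R * (2 * K%:R * 2 ^+ K * s n)))).
      rewrite big_nat_cond [leRHS]big_nat_cond; apply: ler_sum => m /andP[/andP[lm mM] _].
      have m0 := leq_trans lo0 lm.
      by apply: HC; [by []|exact: hE|rewrite n0 ltnW|rewrite m0 ltnW|exact: psi0|exact: psi0].
    rewrite big_split/= -mulr_sumr -/S lerD2l -mulr_suml.
    apply: ler_piMl.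
      by apply: mulr_ge0; [rewrite !mulr_ge0// ltW|exact: s0].
    rewrite (bigD1_seq n)/= ?iota_uniq ?mem_index_iota ?ln// eqxx big1 ?addr0// => m.
    by rewrite eq_sym => /negbTE ->.
  move/le_trans; apply.
  rewrite big_split/= -mulr_suml -!mulr_sumr -/S.
  have : 2 ^+ K * S <= S * S by rewrite ler_pM2r.
  have K0R : (0 : R) < K%:R by rewrite ltr0n.
  move=> hS; have := ler_wpM2l (ltW K0R) hS.
  rewrite expr2; lra.
have [k /andP[k1 kK] Qk] := exists_le_average K0 Qsum.
pose l (p : I) : R := 2 * rad k (tag p).
have lE : \sum_(p | P p) l p = 2 * S / 2 ^+ k.
  rewrite /l (sum_tagged M lo (fun n _ => 2 * rad k n)).
  under eq_bigr do rewrite sum_coprime_const.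
  rewrite /S mulr_sumr mulr_suml; apply: eq_bigr => n _.
  by rewrite /rad; ring.
apply: (@le_trans _ _ (lebesgue_measure (\bigcup_(p in [set p | P p]) A k p))).
  apply: (@chung_erdos _ _ R lebesgue_measure I P (A k) l (fun p p' =>
      ov k (tag p) (tagged p) (tag p') (tagged p'))).
  - by move=> p; exact: measurable_itv.
  - by move=> p _; apply: lebesgue_measure_itvoo_center; exact: rad0.
  - by move=> p; rewrite /l mulr_ge0// rad0.
  - by move=> p p' _ _; apply: lebesgue_measure_overlap; exact: rad0.
  - by rewrite divr_gt0//; lra.
  - by rewrite lE divr_gt0// mulr_gt0.
  rewrite -/(Q k) lE -(ler_pM2l (exprn_gt0 k (ltr0n R 4))).
  apply: (le_trans Qk); rewrite le_eqVlt; apply/orP; left; apply/eqP.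
  have -> : (4 : R) ^+ k = 2 ^+ k * 2 ^+ k by rewrite -exprMn; congr (_ ^+ _); lra.
  by field; rewrite gt_eqF.
have mred n : measurable (reduced_nbhd psi n) by apply: bigcup_measurable.
apply: le_measure; rewrite ?inE.
- by apply: fin_bigcup_measurable; [exact: finite_finset|move=> p _; exact: measurable_itv].
- apply: bigcup_measurable => n _; exact: mred.
move=> x [p] /= /andP[lp cp] Ax.
exists (tag p) => /=; first by rewrite lp ltn_ord.
exists (tagged p : nat) => /=; first by rewrite ltn_ord cp.
move: Ax; rewrite /A /= !in_itv/= /cen /rad.
have n0 : (0 : R) < (tag p)%:R by rewrite ltr0n.
have p0 := psi0 _ (tag0 p).
have : psi (tag p) / (tag p)%:R / 2 ^+ k <= psi (tag p) / (tag p)%:R.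
  rewrite ler_pdivrMr//; apply: ler_peMr; first by rewrite divr_ge0// ltW.
  by rewrite exprn_ege1// ler1n.
rewrite mulrBl mulrDl => hr /andP[h1 h2]; apply/andP; split; lra.
Qed.

(** * A uniform lower bound for the limsup set *)

(* Up to constants, log1 n is 2 ^ h on the block [2 ^ 2 ^ h, 2 ^ 2 ^ h.+1), so if almost all
   blocks had mass below 2 ^ (h %/ E) then the series would be dominated by a geometric one. *)
Lemma heavy_blocks (R : realType) (eps : R) (E : nat) (psi : nat -> R) :
  0 < eps -> 2 <= eps * E%:R ->
  (forall n, (1 <= n)%N -> 0 <= psi n) ->
  (\sum_(1 <= n <oo) (psi n * (totient n)%:R / (n%:R * log1 n%:R `^ eps))%:E = +oo)%E ->
  forall h0, exists2 h, (h0 <= h)%N &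
    2 ^+ (h %/ E) <= \sum_(2 ^ (2 ^ h) <= n < 2 ^ (2 ^ h.+1)) psi n * (totient n)%:R / n%:R.
Proof.
move=> eps0 epsE psi0 div h0; apply: contrapT => no.
have small h : (h0 <= h)%N -> \sum_(2 ^ (2 ^ h)
    <= n < 2 ^ (2 ^ h.+1)) psi n * (totient n)%:R / n%:R < 2 ^+ (h %/ E).
  by move=> hh; rewrite ltNge; apply/negP => H; apply: no; exists h.
pose t n : R := psi n * (totient n)%:R / (n%:R * log1 n%:R `^ eps).
have log_ge1 (x : R) : 1 <= log1 x by rewrite /log1 le_max lexx.
have t0 n : (1 <= n)%N -> 0 <= t n.
  by move=> n1; rewrite divr_ge0// ?mulr_ge0 ?psi0 ?powR_ge0.
have E0 : (0 < E)%N.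
  by rewrite lt0n; apply/eqP => EE; move: epsE; rewrite EE mulr0; lra.
have E0R : (0 : R) < E%:R by rewrite ltr0n.
(* On block h the factor (log n)^-eps is at most r / r^h with r = rho^2, and E >= 2 / eps makes the
   assumed mass 2^(h %/ E) at most rho^h. The block thus contributes at most r q^h with q = 1 / rho
   < 1. *)
pose rho : R := 2 `^ (eps / 2).
have rho1 : 1 < rho.
  have e20 : 0 < eps / 2 by rewrite divr_gt0.
  have := gt0_ltr_powR e20 => /(_ 1 2); rewrite !nnegrE powR1; apply => //.
  by rewrite ltr1n.
have rho0 : 0 < rho by apply: lt_trans rho1.
pose r := rho * rho.
have r0 : 0 < r by rewrite mulr_gt0.
have rE : 2 `^ eps = r.
  by rewrite /r /rho -powRD; [congr (_ `^ _); lra | rewrite pnatr_eq0 implybT].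
pose q := rho^-1.
have q0 : 0 < q by rewrite invr_gt0.
have q1 : q < 1 by rewrite invf_lt1.
have block h : (h0 <= h)%N -> \sum_(2 ^ (2 ^ h) <= n < 2 ^ (2 ^ h.+1)) t n <= r * q ^+ h.
  move=> hh; have rh0 : 0 < r ^+ h by rewrite exprn_gt0.
  apply: (@le_trans _ _ (\sum_(2 ^ (2 ^ h) <= n < 2 ^ (2 ^ h.+1)) (r / r ^+ h) * (psi n
      * (totient n)%:R / n%:R))).
    rewrite big_nat_cond [leRHS]big_nat_cond; apply: ler_sum => n /andP[/andP[n1 _] _].
    have n0 : (0 < n)%N by rewrite (leq_trans _ n1)// expn_gt0.
    have nR : (0 : R) < n%:R by rewrite ltr0n.
    have lg : r ^+ h / r <= log1 n%:R `^ eps.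
      have : 2 ^+ h / 2 <= log1 (n%:R : R).
        rewrite /log1 le_max; apply/orP; right.
        apply: (@le_trans _ _ (ln ((2 ^ (2 ^ h))%N%:R : R))); last first.
          by rewrite ler_ln ?posrE ?ltr0n ?expn_gt0// ler_nat.
        rewrite natrX lnXn// -(mulr_natl (ln 2)) natrX ler_pM2l ?exprn_gt0//.
        exact: ln_two_ge.
      have h2 : (0 : R) <= 2 ^+ h / 2 by rewrite divr_ge0// exprn_ge0.
      move=> /(ge0_ler_powR (ltW eps0)) H.
      apply: le_trans (H _ _); rewrite ?nnegrE//; last first.
        by apply: le_trans (log_ge1 _).
      have i1 : (2^-1 : R) `^ eps = r^-1.
        by rewrite -(powR_inv1 (ler0n R 2)) -powRrM mulN1r powRN rE.
      have i2 : ((2 : R) ^+ h) `^ eps = r ^+ h.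
        by rewrite -(powR_mulrn h (ler0n R 2)) -powRrM mulrC powRrM rE powR_mulrn// ltW.
      by rewrite powRM ?exprn_ge0 ?invr_ge0// i1 i2.
    have lg0 : 0 < r ^+ h / r by rewrite divr_gt0.
    have -> : t n = (psi n * (totient n)%:R / n%:R) * (log1 n%:R `^ eps)^-1.
      by rewrite /t invfM mulrA.
    rewrite mulrC; apply: ler_wpM2r; first by rewrite divr_ge0// mulr_ge0// psi0.
    rewrite -[r / _]invf_div lef_pV2 ?posrE//; apply: lt_le_trans lg.
    exact: lg0.
  rewrite -mulr_sumr -mulrA; apply: ler_wpM2l; first exact: ltW.
  have rhoE : 2 ^+ (h %/ E) <= rho ^+ h.
    rewrite -(powR_mulrn _ (ler0n R 2)) -(powR_mulrn h (ltW rho0)) /rho -powRrM.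
    apply: ler_powR; first by rewrite ler1n.
    have : (h %/ E)%N%:R <= h%:R / E%:R :> R.
      by rewrite ler_pdivlMr// -natrM ler_nat leq_trunc_div.
    move/le_trans; apply; rewrite ler_pdivrMr//.
    have : h%:R * 2 <= h%:R * (eps * E%:R) :> R by rewrite ler_wpM2l.
    lra.
  have rhoh0 : 0 < rho ^+ h by rewrite exprn_gt0.
  rewrite ler_pdivrMl//; apply: (le_trans (ltW (small h hh))).
  by rewrite /q exprVn /r exprMn mulfK// gt_eqF.
pose B0 := \sum_(1 <= n < 2 ^ (2 ^ h0)) t n.
have part d : \sum_(1 <= n < 2 ^ (2 ^ (h0 + d))) t n
    <= B0 + r / (1 - q) * (q ^+ h0 - q ^+ (h0 + d)).
  elim: d => [|d IH]; first by rewrite addn0 subrr mulr0 addr0.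
  rewrite addnS (big_cat_nat (n := 2 ^ (2 ^ (h0 + d))))/= ?expn_gt0//; last first.
    by rewrite leq_exp2l// leq_exp2l.
  apply: (le_trans (lerD IH (block _ (leq_addr _ _)))).
  rewrite exprS le_eqVlt; apply/orP; left; apply/eqP.
  by field; rewrite gt_eqF// subr_gt0.
pose B := B0 + r / (1 - q) * q ^+ h0.
have bnd N : \sum_(1 <= n < N) t n <= B.
  have [d Nd] : exists d, (N <= 2 ^ (2 ^ (h0 + d)))%N.
    exists N; apply: ltnW; apply: leq_trans (ltn_expl _ (erefl : 1 < 2)%N).
    apply: leq_trans (ltnW (ltn_expl _ (erefl : 1 < 2)%N)); lia.
  have c0 : 0 <= r / (1 - q) by rewrite divr_ge0// ?subr_ge0 ltW.
  apply: (@le_trans _ _ (\sum_(1 <= n < 2 ^ (2 ^ (h0 + d))) t n)).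
    have [N1|N1] := leqP 1 N; last first.
      rewrite big_geq; last by rewrite ltnW.
      by rewrite big_nat_cond sumr_ge0// => n /andP[/andP[n1 _] _]; exact: t0.
    rewrite [leRHS](big_cat_nat (n := N))//= lerDl big_nat_cond sumr_ge0//.
    by move=> n /andP[/andP[n1 _] _]; apply: t0; exact: leq_trans n1.
  apply: (le_trans (part d)); rewrite /B lerD2l ler_wpM2l//.
  by rewrite gerBl exprn_ge0// ltW.
have : (\sum_(1 <= n <oo) (t n)%:E <= B%:E)%E.
  apply: lime_le.
    by apply: is_cvg_nneseries => n n1 _; rewrite lee_fin t0.
  by apply: nearW => N; rewrite sumEFin lee_fin bnd.
by rewrite div.
Qed.

(** * Neighbourhoods modulo 1 and their limsup set *)

Lemma approx_setP (R : realType) (psi : nat -> R) (n : nat) (x : R) : (1 <= n)%N ->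
  approx_set psi n x <-> exists2 a : int, coprime `|a| n & `|n%:R * x - a%:~R| < psi n.
Proof.
move=> n1; have n0 : (0 : R) < n%:R by rewrite ltr0n.
have gz : (n%:Z : int) != 0 by rewrite eqz_nat -lt0n.
have inE (y c : R) : (y \in `](c - psi n) / n%:R, (c + psi n) / n%:R[) = (`|n%:R * y - c| < psi n).
  rewrite in_itv/= ltr_pdivrMr// ltr_pdivlMr// ltr_norml (mulrC y).
  by apply/andP/andP => -[h1 h2]; split; lra.
split=> [[k [a [/andP[a1 an] ga]]]/=|[a ca ha]].
  rewrite inE => h; exists (a%:Z - k * n%:Z).
    rewrite -[coprime _ _]/(coprimez (a%:Z - k * n%:Z) n%:Z) /coprimez gcdzC.
    have -> : a%:Z - k * n%:Z = (- k) * n%:Z + a%:Z by ring.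
    by rewrite gcdzMDl /gcdz/= gcdnC ga.
  apply: le_lt_trans h; rewrite le_eqVlt; apply/orP; left; apply/eqP; congr (`| _ |).
  by rewrite rmorphB rmorphM/= -!pmulrn; ring.
(* Dividing a - 1 instead of a yields the representative [r.+1] between 1 and n, the range used by
   [approx_set]. *)
pose q := ((a - 1) %/ n%:Z)%Z; pose r := `|((a - 1) %% n%:Z)%Z|%N.
have rE : r%:Z = ((a - 1) %% n%:Z)%Z by rewrite /r gez0_abs// modz_ge0.
have rn : (r < n)%N by rewrite -ltz_nat rE ltz_pmod// ltz_nat.
have aE : a = q * n%:Z + r.+1%:Z.
  by rewrite -addn1 PoszD rE addrA -divz_eq subrK.
exists (- q); exists r.+1.
  split; first by rewrite ltnS leq0n.
  move: ca; rewrite aE -[coprime _ _]/(coprimez (q * n%:Z + r.+1%:Z) n%:Z) /coprimez gcdzC gcdzMDl.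
  by rewrite /gcdz/= eqz_nat gcdnC => /eqP.
rewrite /= inE; apply: le_lt_trans ha; rewrite le_eqVlt; apply/orP; left; apply/eqP; congr (`| _ |).
by rewrite aE rmorphD rmorphM rmorphN/= -!pmulrn; ring.
Qed.

Lemma reduced_nbhd_sub (R : realType) (psi : nat -> R) (n : nat) : (1 <= n)%N ->
  reduced_nbhd psi n `<=` approx_set psi n.
Proof.
move=> n1 x [a /= /andP[an ca] ax]; apply/approx_setP => //; exists a%:Z => //.
have n0 : (0 : R) < n%:R by rewrite ltr0n.
move: ax; rewrite in_itv/= ltr_pdivrMr// ltr_pdivlMr// ltr_norml (mulrC x) -pmulrn.
by move=> /andP[h1 h2]; apply/andP; split; lra.
Qed.

Lemma approx_set_shift (R : realType) (psi : nat -> R) (n : nat) (x : R) (k : int) :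
  approx_set psi n (x + k%:~R) <-> approx_set psi n x.
Proof.
split=> -[j H]; first by exists (k + j); rewrite rmorphD/= addrA.
exists (j - k); rewrite (_ : x + k%:~R + (j - k)%:~R = x + j%:~R)//.
by rewrite rmorphB/=; ring.
Qed.

Lemma open_approx_set (R : realType) (psi : nat -> R) (n : nat) : open (approx_set psi n).
Proof.
have -> : approx_set psi n = \bigcup_(k : int) ((fun x : R => x + k%:~R) @^-1`
    (\bigcup_(a in [set a : nat | (1 <= a <= n)%N /\ gcdn a n = 1%N])
          [set` `](a%:R - psi n) / n%:R, (a%:R + psi n) / n%:R[])).
  by apply/seteqP; split => x /= [k]; exists k.
apply: bigcup_open => k _; apply: open_comp.
  by move=> x _; apply: cvgD; [exact: cvg_id | exact: cvg_cst].
by apply: bigcup_open => a _; exact: interval_open.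
Qed.

(** The index [n.+1] leaves out the denominator 0. The set is kept periodic on the whole line,
    because the zero-one law applies affine maps to it. *)
Definition limsup_nbhd (R : realType) (psi : nat -> R) : set R :=
  lim_sup_set (fun n => approx_set psi n.+1).

Lemma measurable_approx_set (R : realType) (psi : nat ->
    R) (n : nat) : measurable (approx_set psi n).
Proof. by apply: open_measurable; exact: open_approx_set. Qed.

Lemma measurable_limsup_nbhd (R : realType) (psi : nat -> R) : measurable (limsup_nbhd psi).
Proof.
apply: bigcap_measurable => // k _; apply: bigcup_measurable => n _.
exact: measurable_approx_set.
Qed.

Lemma limsup_nbhdP (R : realType) (psi : nat -> R) (x : R) :
  limsup_nbhd psi x <-> forall N, exists2 n, (N <= n)%N & (1 <= n)%N /\ approx_set psi n x.
Proof.
split=> [H N|H N _].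
  by have [n /= Nn An] := H N I; exists n.+1 => //; exact: leqW.
by have [[|n] Nn [// _ An]] := H N.+1; exists n.
Qed.

Lemma infinite_natP (A : set nat) :
  infinite_set A <-> forall N, exists2 n, (N <= n)%N & A n.
Proof.
split=> [infA N|H finA].
  apply: contrapT => no; apply: infA; apply: (@sub_finite_set _ _ `I_N); last exact: finite_II.
  by move=> n An /=; rewrite ltnNge; apply/negP => Nn; apply: no; exists n.
have [M HM] : exists M, forall n, A n -> (n < M)%N.
  have /finite_seqP[s sE] := finA.
  exists (\max_(i <- s) i).+1 => n; rewrite sE /= ltnS => ns.
  by rewrite (big_rem n)//= leq_maxl.
by have [n Mn /HM] := H M; rewrite ltnNge Mn.
Qed.

Definition weighted_diverges (R : realType) (eps : R) (psi : nat -> R) : Prop :=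
  (\sum_(1 <= n <oo) (psi n * (totient n)%:R / (n%:R * log1 n%:R `^ eps))%:E = +oo)%E.

Lemma lebesgue_measure_shift (R : realType) (b : R) (A : set R) : measurable A ->
  lebesgue_measure ((fun x : R => x + b) @^-1` A) = lebesgue_measure A.
Proof.
move=> mA; rewrite [RHS](@lebesgue_measure_affine R 1 b A)// mul1e.
by congr (lebesgue_measure _); apply/funext => x; rewrite /preimage/= mul1r.
Qed.

Lemma measurable_shift_preimage (R : realType) (b : R) (A : set R) : measurable A ->
  measurable ((fun x : R => x + b) @^-1` A).
Proof.
move=> mA; rewrite -[X in measurable X]setTI.
have : measurable_fun setT (fun x : R => x + b) by apply: measurable_funD.
exact.
Qed.

(* If psi n < n then the neighbourhoods lie in (-1, 2), and folding this onto [0, 1] costs a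
   factor 3. *)
Lemma limsup_nbhd_ge (R : realType) (eps : R) : 0 < eps -> exists2 c : R, 0 < c &
  forall psi : nat -> R, (forall n, (1 <= n)%N -> 0 <= psi n) -> weighted_diverges eps psi ->
  (c%:E <= lebesgue_measure (limsup_nbhd psi `&` `[0%R, 1%R]))%E.
Proof.
move=> eps0; pose E := (Num.truncn (2 / eps)).+1.
have epsE : 2 <= eps * E%:R.
  rewrite mulrC -ler_pdivrMr//; apply: ltW; rewrite /E.
  by have /andP[] := truncn_itv (divr_ge0 (ler0n R 2) (ltW eps0)).
have E0 : (0 < E)%N by [].
clearbody E; have [c0 c00 Hc] := block_measure_ge R E.
exists (Num.min 1 (c0 / 3)); first by rewrite lt_min ltr01 divr_gt0.
move=> psi psi0 div.
have mL := measurable_limsup_nbhd psi.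
(* When psi n >= n infinitely often the numerator 1 alone suffices, since |n x - 1| < n for 0 < x <
   1. *)
have [big|small] := pselect (forall N, exists2 n, (N <= n)%N & (1 <= n)%N /\ n%:R <= psi n).
  apply: (@le_trans _ _ (lebesgue_measure (`]0, 1[%classic : set R))).
    by rewrite lebesgue_measure_itv/= lte_fin ltr01 -EFinB subr0 lee_fin ge_min lexx.
  apply: le_measure; rewrite ?inE//; first exact: measurableI.
  move=> x /= /andP[x0 x1]; split; last by rewrite /= in_itv/= !ltW.
  apply/limsup_nbhdP => N; have [n Nn [n1 npsi]] := big N; exists n => //; split=> //.
  apply/approx_setP => //; exists 1; first by rewrite /= coprime1n.
  apply: lt_le_trans npsi; have n1R : (1 : R) <= n%:R by rewrite ler1n.
  have nx0 : 0 < n%:R * x by rewrite mulr_gt0// (lt_le_trans ltr01).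
  have nx1 : n%:R * x < n%:R by rewrite gtr_pMr// (lt_le_trans ltr01).
  by rewrite mulr1z ltr_norml; apply/andP; split; lra.
have {small} [N0 psiN] : exists N, forall n, (N <= n)%N -> (1 <= n)%N -> psi n < n%:R.
  apply: contrapT => no; apply: small => N; apply: contrapT => no2; apply: no; exists N => n Nn n1.
  by rewrite ltNge; apply/negP => h; apply: no2; exists n.
pose F n := approx_set psi n.+1 `&` `[0, 1]%classic.
have mF n : measurable (F n) by apply: measurableI => //; exact: measurable_approx_set.
have FI n : \bigcup_(j >= n) F j `<=` `[0, 1]%classic by move=> x [j _ []].
have mV n : measurable (\bigcup_(j >= n) F j) by apply: bigcup_measurable => j _.
have tail n : ((c0 / 3)%:E <= lebesgue_measure (\bigcup_(j >= n) F j))%E.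
  set V := \bigcup_(j in _) _.
  (* Taking h beyond [N0] ensures psi m < m on the block, beyond [n] that the block lies in the
     tail, and beyond [E] that K = h %/ E is positive. *)
  have [h hh SK] := heavy_blocks eps0 epsE psi0 div (N0 + n + E).+1.
  have K0 : (0 < h %/ E)%N by rewrite divn_gt0//; lia.
  (* From h < (K + 1) E and K >= 1; the 2 in the condition h <= 2 E K is for this rounding. *)
  have hE : (h <= 2 * E * (h %/ E))%N.
    have := ltn_ceil h E0; move: K0; move: (h %/ E)%N => K K0 h1; nia.
  have := Hc h (h %/ E)%N psi K0 hE psi0 SK.
  set U := \bigcup_(m in _) _ => cU.
  have hlo : (h < 2 ^ (2 ^ h))%N.
    by apply: leq_trans (ltn_expl _ (erefl : 1 < 2)%N) _; apply: ltnW; exact: ltn_expl.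
  have UV : U `<=` ((fun x : R => x + 1) @^-1` V) `|` (V `|` ((fun x : R => x + (-1)) @^-1` V)).
    move=> x [m /= /andP[lom _] xm].
    have hm : (h < m)%N := leq_trans hlo lom.
    have m1 : (1 <= m)%N by apply: leq_trans hm.
    have mN : (N0 <= m)%N by lia.
    have ax := reduced_nbhd_sub m1 xm.
    have inV (k : int) : 0 <= x + k%:~R <= 1 -> V (x + k%:~R).
      move=> xk; exists m.-1 => /=; first by lia.
      by rewrite /F prednK//; split; [apply/approx_set_shift | rewrite /= in_itv].
    have pm := psiN m mN m1.
    case: xm => a /= /andP[am _]; rewrite in_itv/=.
    have mR : (0 : R) < m%:R by rewrite ltr0n.
    have aR : (a%:R : R) <= m%:R by rewrite ler_nat ltnW.
    have a0 : (0 : R) <= a%:R by [].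
    rewrite ltr_pdivrMr// ltr_pdivlMr// => /andP[h1 h2].
    have x1 : -1 < x by nra.
    have x2 : x < 2 by nra.
    have [xn|xp] := ltP x 0.
      by left; have /= := inV 1; apply; apply/andP; split; lra.
    have [x01|x12] := leP x 1.
      by right; left; have /= := inV 0; rewrite addr0; apply; rewrite xp.
    by right; right; have /= := inV (-1); rewrite rmorphN1; apply; apply/andP; split; lra.
  have mVn : measurable V by exact: mV.
  have m1 := measurable_shift_preimage 1 mVn.
  have m2 := measurable_shift_preimage (-1) mVn.
  have mU : measurable U.
    by apply: bigcup_measurable => m _; apply: bigcup_measurable => a _; exact: measurable_itv.
  have cV : (c0%:E <= lebesgue_measure V + (lebesgue_measure V + lebesgue_measure V))%E.
    apply: (le_trans cU); apply: (@le_trans _ _ (lebesgue_measure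
      (((fun x : R => (x + 1)%R) @^-1` V) `|` (V `|` ((fun x : R => (x + (-1))%R) @^-1` V))))).
      by apply: le_measure; rewrite ?inE//; apply: measurableU => //; exact: measurableU.
    apply: (le_trans (measureU2 lebesgue_measure m1 (measurableU _ _ mVn m2))).
    have eqle (x y : \bar R) : x = y -> (x <= y)%E by move=> ->.
    apply: leeD; first exact/eqle/lebesgue_measure_shift.
    apply: (le_trans (measureU2 lebesgue_measure mVn m2)); apply: leeD => //.
    exact/eqle/lebesgue_measure_shift.
  move: cV; case: (lebesgue_measure V) (measure_ge0 lebesgue_measure V) => [v| |]//=;
      rewrite ?leey//.
  by move=> _; rewrite -!EFinD !lee_fin => cv; rewrite ler_pdivrMr//; lra.
have fin0 : (lebesgue_measure (\bigcup_(j >= 0) F j) < +oo)%E.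
  apply: (@le_lt_trans _ _ (lebesgue_measure (`[0, 1]%classic : set R))).
    by apply: le_measure; rewrite ?inE; [exact: mV|exact: measurable_itv|exact: FI].
  by rewrite lebesgue_measure_itv/= lte_fin ltr01 -EFinB ltry.
have cv := lim_sup_set_cvg lebesgue_measure F mF fin0.
have : ((c0 / 3)%:E <= lebesgue_measure (lim_sup_set F))%E.
  by rewrite -(cvg_lim _ cv)//; apply: lime_ge; [apply/cvg_ex; eexists; exact: cv | exact: nearW].
move=> H; apply: (@le_trans _ _ (c0 / 3)%:E); first by rewrite lee_fin ge_min lexx orbT.
apply: (le_trans H); apply: le_measure; rewrite ?inE//.
- by apply: bigcap_measurable => // k _; exact: mV.
- exact: measurableI.
move=> x Fx; split; last by have [j _ []] := Fx 0%N I.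
by move=> k _; have [j kj []] := Fx k I; exists j.
Qed.

(** * Zero-one law *)

Lemma setD_measurable_itv (R : realType) (i : interval R) (A : set R) :
  measurable A -> measurable ([set` i] `\` A).
Proof. by move=> mA; apply: measurableD. Qed.

(** Two consecutive integer translates of a unit window cover [0, 1], and the complement of A is
    periodic. *)
Lemma lebesgue_measure_fold (R : realType) (A : set R) (w : R) : measurable A ->
  (forall (x : R) (k : int), A x -> A (x + k%:~R)) ->
  (lebesgue_measure (`[0%R, 1%R] `\` A) <=
   lebesgue_measure (`[w, (w + 1)%R] `\` A) + lebesgue_measure (`[w, (w + 1)%R] `\` A))%E.
Proof.
move=> mA perA; set B := `[w, (w + 1)%R] `\` A.
have mB : measurable B by exact: setD_measurable_itv.
pose k := Num.floor w; pose l : R := k%:~R; pose l1 : R := (k + 1)%:~R.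
have lE : l1 = l + 1 by rewrite /l1 rmorphD.
have kw : l <= w < l1 by rewrite /l /l1 floor_itv.
have ml := measurable_shift_preimage l mB.
have ml1 := measurable_shift_preimage l1 mB.
have sub : `[0, 1] `\` A `<=` ((fun x : R => x + l) @^-1` B) `|` ((fun x : R => x + l1) @^-1` B).
  move=> x [/=]; rewrite in_itv/= => /andP[x0 x1] nA.
  have nAk (j : int) : ~ A (x + j%:~R).
    by move=> /(perA _ (- j)); rewrite rmorphN/= addrK.
  have [h|h] := leP w (x + l).
    left; split; last exact: nAk.
    by rewrite /= in_itv/= h/=; case/andP: kw; lra.
  right; split; last exact: nAk.
  by rewrite /= in_itv/=; case/andP: kw => k1 k2; apply/andP; split; lra.
have eqle (x y : \bar R) : x = y -> (x <= y)%E by move=> ->.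
apply: (@le_trans _ _ (lebesgue_measure (((fun x : R => x + l) @^-1` B) `|` ((fun x : R =>
    x + l1) @^-1` B)))).
  apply: le_measure; rewrite ?inE; [exact: setD_measurable_itv|exact: measurableU|exact: sub].
apply: (le_trans (measureU2 lebesgue_measure ml ml1)).
by apply: leeD; exact/eqle/lebesgue_measure_shift.
Qed.

(* A point of density of A sees A fill almost all of [x, x + 2 ^- nu], and magnification turns
   the small defect there into a bound on the whole complement. *)
Lemma zero_one_magnification (R : realType) (A : set R) : measurable A ->
  (forall (x : R) (k : int), A x -> A (x + k%:~R)) ->
  (0 < lebesgue_measure A)%E ->
  (forall (nu : nat) (x : R), exists w : R,
    (lebesgue_measure (`[w, (w + 1)%R] `\` A) <=
      (2 ^+ nu)%:E * lebesgue_measure (`[x, (x + (2 ^+ nu)^-1)%R] `\` A))%E) ->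
  lebesgue_measure (`[0%R, 1%R] `\` A) = 0%E.
Proof.
move=> mA perA A0 mag.
have [N [mN N0 NA]] := lebesgue_density mA.
have [x [Ax dx]] : exists x, A x /\ (lebesgue_measure (A `&` ball x r) / lebesgue_measure (ball x
    r))%E @[r --> 0^'+] --> (1%:E : \bar R).
  apply: contrapT => no; move: A0; apply/negP; rewrite -leNgt -N0.
  apply: le_measure; rewrite ?inE// => x Ax; apply: NA => /= H; apply: no; exists x; split=> //.
  by move: H; rewrite indicE mem_set.
clear A0.
(* With e = 2^-nu, the ball of radius 2 e has length 4 e, contains [x, x + e] and misses A on at
   most 4 e eta. Magnification by 1 / e bounds the defect in a unit window by 4 eta, and folding
   onto [0, 1] doubles it. *)
have bound (eta : R) : 0 < eta -> (lebesgue_measure (`[0%R, 1%R] `\` A) <= (8 * eta)%:E)%E.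
  move=> eta0.
  have : \forall r \near (0 : R)^'+, ((1 - eta)%:E < lebesgue_measure (A `&` ball x r) /
      lebesgue_measure (ball x r))%E.
    have : nbhs (1%:E : \bar R) [set y | ((1 - eta)%:E < y)%E].
      by apply: open_nbhs_nbhs; split; [exact: open_ereal_gt_ereal|rewrite /= lte_fin gtrBl].
    exact: dx.
  move=> /nbhs_ballP[d /= d0 Hd].
  have [nu Hnu] : exists nu, 2 * (2 ^+ nu)^-1 < d.
    exists (Num.truncn (2 / d)).+1; rewrite ltr_pdivrMr ?exprn_gt0// mulrC -ltr_pdivrMr//.
    have /andP[_ h] := truncn_itv (divr_ge0 (ler0n R 2) (ltW d0)).
    apply: (lt_trans h); rewrite -natrX ltr_nat; exact: ltn_expl.
  set e := (2 ^+ nu)^-1 in Hnu.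
  have e0 : 0 < e by rewrite invr_gt0 exprn_gt0.
  have r0 : 0 < 2 * e by rewrite mulr_gt0.
  have bd : ball (0 : R) d (2 * e) by rewrite /ball/= sub0r normrN gtr0_norm.
  have := Hd (2 * e) bd r0; rewrite /= lebesgue_measure_ball; last exact: ltW.
  have mAb : measurable (A `&` ball x (2 * e)) by apply: measurableI => //; exact: measurable_ball.
  have mBb : measurable (ball x (2 * e) `\` A) by apply: measurableD => //; exact: measurable_ball.
  have split_ball : (lebesgue_measure (A `&` ball x (2 * e))
      + lebesgue_measure (ball x (2 * e) `\` A) = (2 * e *+ 2)%:E)%E.
    rewrite -(lebesgue_measure_ball x (ltW r0)) -measureU//; last first.
      by apply/seteqP; split => // y [[Ay _] [_ nAy]].
    congr (lebesgue_measure _); apply/seteqP; split => y /=; first by case=> -[].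
    by move=> yb; have [Ay|nAy] := pselect (A y); [left|right].
  move: split_ball; set a := lebesgue_measure (A `&` _);
      set b := lebesgue_measure (ball x (2 * e) `\` A) => ab.
  have fa : a \is a fin_num.
    rewrite ge0_fin_numE ?measure_ge0//; apply: (@le_lt_trans _ _ (2 * e *+ 2)%:E);
        last exact: ltry.
    by rewrite -ab leeDl// measure_ge0.
  have fb : b \is a fin_num.
    rewrite ge0_fin_numE ?measure_ge0//; apply: (@le_lt_trans _ _ (2 * e *+ 2)%:E);
        last exact: ltry.
    by rewrite -ab leeDr// measure_ge0.
  move: ab; rewrite -(fineK fa) -(fineK fb) -EFinD => -[ab].
  rewrite inver; case: ifPn => [/eqP h|_]; first by exfalso; rewrite mulr2n in h; clear -h r0; lra.
  rewrite -EFinM lte_fin ltr_pdivlMr; last by rewrite mulr2n; clear -r0; lra.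
  move=> da.
  have [w Hw] := mag nu x.
  apply: (le_trans (lebesgue_measure_fold w mA perA)).
  have small : (lebesgue_measure (`[w, (w + 1)%R] `\` A) <= (4 * eta)%:E)%E.
    apply: (le_trans Hw).
    apply: (@le_trans _ _ ((2 ^+ nu)%:E * b)%E).
      apply: lee_wpmul2l; first by rewrite lee_fin exprn_ge0.
      apply: le_measure; rewrite ?inE//; first exact: setD_measurable_itv.
      move=> y [/= yI nAy]; split=> //; move: yI; rewrite in_itv/= -/e => /andP[h1 h2].
      by rewrite /ball/= ltr_norml; apply/andP; split; clear -h1 h2 e0; lra.
    rewrite -(fineK fb) -EFinM lee_fin -[2 ^+ nu]invrK -/e mulrC ler_pdivrMr//.
    by move: da ab; rewrite !mulr2n; clear; lra.
  apply: (le_trans (leeD small small)); rewrite -EFinD lee_fin; clear; lra.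
apply/eqP; rewrite eq_le measure_ge0 andbT; apply/lee_addgt0Pr => eta eta0.
rewrite add0e; have := @bound (eta / 8); rewrite divr_gt0// => /(_ isT).
by rewrite mulrC divfK.
Qed.

Lemma weighted_diverges_scale (R : realType) (eps c : R) (psi : nat -> R) : 0 < c ->
  (forall n, (1 <= n)%N -> 0 <= psi n) -> weighted_diverges eps psi ->
  weighted_diverges eps (fun n => c * psi n).
Proof.
move=> c0 psi0 div; rewrite /weighted_diverges.
under eq_eseriesr do rewrite -!mulrA EFinM mulrA.
rewrite nneseriesZl//; first by rewrite div gt0_muley// lte_fin.
move=> [|n] _; rewrite lee_fin; first by rewrite mulr0n mul0r invr0 mulr0.
by rewrite divr_ge0// mulr_ge0// ?psi0 ?powR_ge0.
Qed.

Lemma weighted_diverges_add (R : realType) (eps : R) (psi a b : nat -> R) :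
  (forall n, (1 <= n)%N -> 0 <= a n) -> (forall n, (1 <= n)%N -> 0 <= b n) ->
  (forall n, psi n = a n + b n) ->
  weighted_diverges eps psi -> ~ weighted_diverges eps a -> weighted_diverges eps b.
Proof.
move=> a0 b0 ab div na; rewrite /weighted_diverges in div na *.
have pos (f : nat -> R) : (forall n, (1 <= n)%N -> 0 <= f n) -> forall n, (1 <= n)%N -> true ->
    (0 <= (f n * (totient n)%:R / (n%:R * log1 n%:R `^ eps))%:E)%E.
  by move=> f0 n n1 _; rewrite lee_fin divr_ge0// ?mulr_ge0 ?f0 ?powR_ge0.
apply: contrapT => nb; move: div.
under eq_eseriesr do rewrite ab !mulrDl EFinD.
rewrite nneseriesD; [|exact: pos|exact: pos].
move: na nb => /eqP; rewrite -ltey => na /eqP; rewrite -ltey => nb E.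
by have := lte_add_pinfty na nb; rewrite E.
Qed.

Lemma limsup_nbhd_map (R : realType) (phi phi' : nat -> R) (x y : R) :
  (forall n, (1 <= n)%N -> approx_set phi n x -> approx_set phi' n y) ->
  limsup_nbhd phi x -> limsup_nbhd phi' y.
Proof.
move=> H /limsup_nbhdP L; apply/limsup_nbhdP => N.
by have [n Nn [n1 An]] := L N; exists n => //; split=> //; exact: H.
Qed.

Lemma limsup_nbhd_shift (R : realType) (phi : nat -> R) (x : R) (k : int) :
  limsup_nbhd phi x -> limsup_nbhd phi (x + k%:~R).
Proof. by apply: limsup_nbhd_map => n _ An; apply/approx_set_shift. Qed.

Lemma limsup_nbhd_mono (R : realType) (phi phi' : nat -> R) :
  (forall n, (1 <= n)%N -> phi n <= phi' n) -> limsup_nbhd phi `<=` limsup_nbhd phi'.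
Proof.
move=> le x; apply: limsup_nbhd_map => n n1 /(approx_setP _ _ n1)[a ca ha].
by apply/(approx_setP _ _ n1); exists a => //; exact: lt_le_trans (le n n1).
Qed.

(* The bound of limsup_nbhd_ge does not depend on psi, so it survives decreasing intersections. *)
Lemma bigcap_limsup_nbhd_gt0 (R : realType) (eps : R) (phi : nat -> nat -> R) : 0 < eps ->
  (forall nu n, (1 <= n)%N -> 0 <= phi nu n) ->
  (forall nu n, (1 <= n)%N -> phi nu.+1 n <= phi nu n) ->
  (forall nu, weighted_diverges eps (phi nu)) ->
  (0 < lebesgue_measure (\bigcap_nu limsup_nbhd (phi nu)))%E.
Proof.
move=> eps0 phi0 dec div; have [c c0 Hc] := limsup_nbhd_ge eps0.
pose F nu := limsup_nbhd (phi nu) `&` `[0, 1]%classic.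
have mL := @measurable_limsup_nbhd R.
have mF nu : measurable (F nu) by exact: measurableI.
have mcF : measurable (\bigcap_nu F nu) by apply: bigcap_measurable.
have fin0 : (lebesgue_measure (F 0%N) < +oo)%E.
  apply: (@le_lt_trans _ _ (lebesgue_measure (`[0, 1]%classic : set R))).
    by apply: le_measure; rewrite ?inE; [exact: mF|exact: measurable_itv|exact: subIsetr].
  by rewrite lebesgue_measure_itv/= lte_fin ltr01 -EFinB ltry.
have monoF : {homo F : n m / (n <= m)%N >-> (m <= n)%O}.
  move=> m n mn; apply/subsetPset => x [Lx Ix]; split=> //.
  apply: limsup_nbhd_mono Lx => k k1; rewrite -(subnK mn).
  by elim: (n - m)%N => //= d IH; rewrite addSn; exact: le_trans (dec _ _ k1) IH.
have cv := nonincreasing_cvg_mu fin0 mF mcF monoF.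
have H : (c%:E <= lebesgue_measure (\bigcap_nu F nu))%E.
  rewrite -(cvg_lim _ cv)//; apply: lime_ge; first by apply/cvg_ex; eexists; exact: cv.
  by apply: nearW => nu; apply: Hc => //; exact: phi0.
apply: (@lt_le_trans _ _ c%:E); first by rewrite lte_fin.
apply: (le_trans H); apply: le_measure; rewrite ?inE//.
  by apply: bigcap_measurable => // nu _; exact: mL.
by move=> x Fx nu _; have [] := Fx nu I.
Qed.

Lemma coprime_no_prime (x n : nat) : (0 < n)%N ->
  (forall p, prime p -> (p %| x)%N -> (p %| n)%N -> False) -> coprime x n.
Proof.
move=> n0 H; rewrite /coprime eqn_leq gcdn_gt0 n0 orbT andbT leqNgt; apply/negP => g1.
have := pdiv_dvd (gcdn x n); rewrite dvdn_gcd => /andP[px pn].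
exact: (H _ (pdiv_prime g1) px pn).
Qed.

(** The nu-th iterate is z -> 2^nu z + d and maps A into A, so a point z of [x, x + 2^-nu] whose
    image avoids A avoids A itself. The defect of a unit window therefore pulls back into that of
    the short interval, and the change of variable gives the factor 2^nu. *)
Lemma zero_one_doubling (R : realType) (A : set R) (b : R) : measurable A ->
  (forall (x : R) (k : int), A x -> A (x + k%:~R)) -> (0 < lebesgue_measure A)%E ->
  (forall x, A x -> A (2 * x + b)) -> lebesgue_measure (`[0%R, 1%R] `\` A) = 0%E.
Proof.
move=> mA perA A0 HT; apply: zero_one_magnification => // nu x.
have [d Hd] : exists d, forall z, A z -> A (2 ^+ nu * z + d).
  elim: nu => [|nu [d Hd]]; first by exists 0 => z; rewrite expr0 mul1r addr0.
  exists (2 * d + b) => z /Hd/HT.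
  by congr (A _); rewrite exprS; ring.
exists (2 ^+ nu * x + d).
have e0 : 0 < (2 : R) ^+ nu by rewrite exprn_gt0.
set w := 2 ^+ nu * x + d.
have mB : measurable (`[w, w + 1] `\` A) by exact: setD_measurable_itv.
rewrite (lebesgue_measure_affine d e0 mB); apply: lee_wpmul2l; first by rewrite lee_fin ltW.
apply: le_measure; rewrite ?inE.
- rewrite -[X in measurable X]setTI.
  have mf : measurable_fun setT (fun z : R => 2 ^+ nu * z + d).
    by apply: measurable_funD => //; apply: measurable_funM.
  exact: mf.
- exact: setD_measurable_itv.
move=> z [/=]; rewrite !in_itv/= => /andP[h1 h2] nA; split; last by move=> /Hd.
apply/andP; split.
  by move: h1; rewrite /w lerD2r ler_pM2l.
by rewrite -(ler_pM2l e0) mulrDr divff ?gt_eqF//; move: h2; rewrite /w; clear; lra.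
Qed.

(** The window [x, x + 1] is cut into 2^nu intervals of length e. A point outside A in the m-th one,
    moved back by m e, is still outside A, so no interval has a larger defect than the first. *)
Lemma zero_one_dyadic_shift (R : realType) (A : set R) : measurable A ->
  (forall (x : R) (k : int), A x -> A (x + k%:~R)) -> (0 < lebesgue_measure A)%E ->
  (forall nu x, A x -> A (x + (2 ^+ nu)^-1)) -> lebesgue_measure (`[0%R, 1%R] `\` A) = 0%E.
Proof.
move=> mA perA A0 HT; apply: zero_one_magnification => // nu x; exists x.
set e : R := (2 ^+ nu)^-1; have e0 : 0 < e by rewrite invr_gt0 exprn_gt0.
have HTm m z : A z -> A (z + m%:R * e).
  elim: m z => [|m IH] z Az; first by rewrite mul0r addr0.
  by rewrite -natr1 mulrDl mul1r addrA; apply/HT/IH.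
set J := `[x, (x + e)%R] `\` A.
have mJ : measurable J by exact: setD_measurable_itv.
suff main m : (lebesgue_measure (`[x, (x + m%:R * e)%R] `\` A) <= m%:R%:E * lebesgue_measure J)%E.
  have e1 : 2 ^+ nu * e = 1 by rewrite /e divff// gt_eqF// exprn_gt0.
  by have := main (2 ^ nu)%N; rewrite natrX e1.
elim: m => [|m IH].
  rewrite mul0r addr0 mul0e; apply: (@le_trans _ _ (lebesgue_measure (`[x, x]%classic : set R))).
    by apply: le_measure; rewrite ?inE; [exact: setD_measurable_itv|exact: measurable_itv|exact:
        subDsetl].
  by rewrite lebesgue_measure_itv/= ltxx.
pose s : R := - (m%:R * e).
have ms := measurable_shift_preimage s mJ.
have m1 : measurable (`[x, x + m%:R * e] `\` A) by exact: setD_measurable_itv.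
apply: (@le_trans _ _ (lebesgue_measure ((`[x,
    x + m%:R * e] `\` A) `|` ((fun z : R => z + s) @^-1` J)))).
  apply: le_measure; rewrite ?inE; [exact: setD_measurable_itv|exact: measurableU|].
  move=> y [/=]; rewrite in_itv/= -natr1 mulrDl mul1r => /andP[h1 h2] nA.
  have [h|h] := leP y (x + m%:R * e).
    by left; split=> //=; rewrite in_itv/= h1.
  right; split; last by move=> /(HTm m); rewrite /s subrK.
  by rewrite /= in_itv/= /s; apply/andP; split; lra.
apply: (le_trans (measureU2 lebesgue_measure m1 ms)).
have eqle (u v : \bar R) : u = v -> (u <= v)%E by move=> ->.
rewrite -natr1 EFinD ge0_muleDl ?lee_fin// mul1e; apply: leeD; first exact: IH.
exact/eqle/lebesgue_measure_shift.
Qed.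

(** * The alternative on 2-adic valuations *)

Section two_adic.
Variables (R : realType) (psi : nat -> R) (eps : R).
Hypotheses (psi0 : forall n, (1 <= n)%N -> 0 <= psi n) (eps0 : 0 < eps).

Definition val_eq (r : nat) (n : nat) : R := if logn 2 n == r then psi n else 0.
Definition val_ge (r : nat) (n : nat) : R := if (r <= logn 2 n)%N then psi n else 0.

Lemma val_eq_ge0 r n : (1 <= n)%N -> 0 <= val_eq r n.
Proof. by move=> n1; rewrite /val_eq; case: ifP => // _; exact: psi0. Qed.

Lemma val_ge_ge0 r n : (1 <= n)%N -> 0 <= val_ge r n.
Proof. by move=> n1; rewrite /val_ge; case: ifP => // _; exact: psi0. Qed.

Lemma val_ge_split r n : val_ge r n = val_eq r n + val_ge r.+1 n.
Proof. by rewrite /val_ge /val_eq; case: ltngtP => _; rewrite ?addr0 ?add0r. Qed.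

(* If logn 2 n = r then x -> 2x + 2^-r maps a / n to a reduced fraction with denominator n, since
   n / 2^r is odd. *)
Lemma full_of_val_eq (r : nat) : weighted_diverges eps (val_eq r) ->
  lebesgue_measure (`[0%R, 1%R] `\` limsup_nbhd psi) = 0%E.
Proof.
(* Doubling x doubles the error n x - a, so the map carries level [nu.+1] into level [nu]; only the
   intersection of all levels is stable. *)
move=> div; pose phi nu n := (2 ^+ nu)^-1 * val_eq r n.
have e0 nu : 0 < ((2 : R) ^+ nu)^-1 by rewrite invr_gt0 exprn_gt0.
have phi0 nu n : (1 <= n)%N -> 0 <= phi nu n.
  by move=> n1; rewrite mulr_ge0 ?val_eq_ge0// ltW.
have dec nu n : (1 <= n)%N -> phi nu.+1 n <= phi nu n.
  move=> n1; rewrite ler_wpM2r ?val_eq_ge0// lef_pV2 ?posrE ?exprn_gt0//.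
  by rewrite ler_weXn2l// ler1n.
set A := \bigcap_nu limsup_nbhd (phi nu).
have mA : measurable A by apply: bigcap_measurable => // nu _; exact: measurable_limsup_nbhd.
have A0 : (0 < lebesgue_measure A)%E.
  apply: bigcap_limsup_nbhd_gt0 eps0 phi0 dec _ => nu.
  by apply: weighted_diverges_scale => // n n1; exact: val_eq_ge0.
have perA (x : R) (k : int) : A x -> A (x + k%:~R).
  by move=> Ax nu _; apply/limsup_nbhd_shift/Ax.
have HT x : A x -> A (2 * x + (2 ^+ r)^-1).
  move=> Ax nu _; have := Ax nu.+1 I; apply: limsup_nbhd_map => n n1 /(approx_setP _ _ n1)[a ca ha].
  (* At other valuations [val_eq] is 0 and the strict inequality has no solution. *)
  have [rE pE] : logn 2 n = r /\ val_eq r n = psi n.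
    move: ha; rewrite /phi /val_eq; case: eqP => [->//|_].
    by rewrite mulr0 ltNge normr_ge0.
  have rn : (2 ^ r %| n)%N by rewrite pfactor_dvdn// rE.
  pose m := (n %/ 2 ^ r)%N.
  have nE : n = (m * 2 ^ r)%N by rewrite divnK.
  have m2 : ~~ (2 %| m)%N.
    apply/negP => /dvdnP[k mE]; have : (2 ^ r.+1 %| n)%N.
      by rewrite nE mE -mulnA -expnS dvdn_mull.
    by rewrite pfactor_dvdn// rE ltnn.
  (* A prime dividing n divides m or is 2. In the first case it is odd and would have to divide a;
     in the second it cannot divide 2 a + m, as m is odd. *)
  apply/(approx_setP _ _ n1); exists (2 * a + m%:Z).
    apply: coprime_no_prime => // p pp pa pn.
    have pa' : (p%:Z %| 2 * a + m%:Z)%Z by [].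
    have : (p %| m * 2 ^ r)%N by rewrite -nE.
    rewrite Euclid_dvdM// => /orP[pm|].
      have : (p%:Z %| 2 * a)%Z.
        by rewrite -(addrK m%:Z (2 * a)) rpredB.
      have -> : (p%:Z %| 2 * a)%Z = (p %| 2 * `|a|)%N by rewrite dvdzE abszM.
      rewrite Euclid_dvdM// => /orP[p2|pa2]; last exact: (coprime_prime_dvd pp ca pa2 pn).
      move: p2; rewrite dvdn_prime2// => /eqP p2; move: m2.
      by rewrite -p2 pm.
    rewrite Euclid_dvdX// => /andP[]; rewrite dvdn_prime2// => /eqP p2 _.
    move/negP: m2; apply; rewrite -p2.
    suff : (p%:Z %| m%:Z)%Z by [].
    by rewrite -(addrK (2 * a) m%:Z) (addrC m%:Z) rpredB// p2 dvdz_mulr.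
  have -> : n%:R * (2 * x + (2 ^+ r)^-1) - (2 * a + m%:Z)%:~R = 2 * (n%:R * x - a%:~R) :> R.
    have nR : n%:R = m%:R * 2 ^+ r :> R by rewrite {1}nE natrM natrX.
    have : (2 : R) ^+ r != 0 by rewrite expf_neq0.
    rewrite rmorphD rmorphM/= -!pmulrn nR; move: (2 ^+ r) => v v0.
    by field.
  rewrite normrM ger0_norm// /phi -ltr_pdivlMl//.
  by move: ha; rewrite /phi exprS invfM mulrA.
have AL : A `<=` limsup_nbhd psi.
  move=> x Ax; have := Ax 0%N I; apply: limsup_nbhd_mono => n n1.
  rewrite /phi expr0 invr1 mul1r /val_eq; case: ifP => // _; exact: psi0.
have mL := measurable_limsup_nbhd psi.
apply/eqP; rewrite eq_le measure_ge0 andbT -(zero_one_doubling mA perA A0 HT).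
apply: le_measure; rewrite ?inE; [exact: setD_measurable_itv|exact: setD_measurable_itv|].
exact: setDS.
Qed.

(* Adding 2^-nu to a / n gives a reduced fraction with denominator n as soon as 2^(nu+1) | n,
   since then n / 2^nu is divisible by every prime factor of n. *)
Lemma full_of_val_ge : (forall r, weighted_diverges eps (val_ge r)) ->
  lebesgue_measure (`[0%R, 1%R] `\` limsup_nbhd psi) = 0%E.
Proof.
move=> div; pose phi nu := val_ge nu.+1.
have phi0 nu n : (1 <= n)%N -> 0 <= phi nu n by exact: val_ge_ge0.
have dec nu n : (1 <= n)%N -> phi nu.+1 n <= phi nu n.
  move=> n1; rewrite {2}/phi val_ge_split lerDr; exact: val_eq_ge0.
set A := \bigcap_nu limsup_nbhd (phi nu).
have mA : measurable A by apply: bigcap_measurable => // nu _; exact: measurable_limsup_nbhd.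
have A0 : (0 < lebesgue_measure A)%E.
  by apply: bigcap_limsup_nbhd_gt0 eps0 phi0 dec _ => nu; exact: div.
have perA (x : R) (k : int) : A x -> A (x + k%:~R).
  by move=> Ax nu _; apply/limsup_nbhd_shift/Ax.
have HT nu x : A x -> A (x + (2 ^+ nu)^-1).
  (* Level s + nu forces the valuation of n above both s and nu: above nu to keep the shifted
     fraction reduced, above s to remain in level s. *)
  move=> Ax s _; have := Ax (s + nu)%N I; apply: limsup_nbhd_map =>
      n n1 /(approx_setP _ _ n1)[a ca ha].
  have rE : (s + nu < logn 2 n)%N.
    move: ha; rewrite /phi /val_ge; case: ifP => // _.
    by rewrite ltNge normr_ge0.
  have phiE : phi (s + nu)%N n = phi s n.
    by rewrite /phi /val_ge rE ifT// (leq_ltn_trans _ rE)// leq_addr.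
  have rn : (2 ^ nu.+1 %| n)%N by rewrite pfactor_dvdn// (leq_ltn_trans _ rE)// leq_addl.
  pose m := (n %/ 2 ^ nu.+1)%N.
  have nE : n = (2 * m * 2 ^ nu)%N by rewrite mulnAC -expnS mulnC divnK.
  apply/(approx_setP _ _ n1); exists (a + (2 * m)%N%:Z).
    apply: coprime_no_prime => // p pp pa pn.
    have pa' : (p%:Z %| a + (2 * m)%N%:Z)%Z by [].
    have p2m : (p %| 2 * m)%N.
      have : (p %| 2 * m * 2 ^ nu)%N by rewrite -nE.
      rewrite Euclid_dvdM// => /orP[//|]; rewrite Euclid_dvdX// => /andP[p2 _].
      exact: dvdn_mulr.
    have : (p%:Z %| a)%Z by rewrite -(addrK (2 * m)%N%:Z a) rpredB.
    by move=> pa2; exact: (coprime_prime_dvd pp ca pa2 pn).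
  have -> : n%:R * (x + (2 ^+ nu)^-1) - (a + (2 * m)%N%:Z)%:~R = n%:R * x - a%:~R :> R.
    have nR : n%:R = (2 * m)%N%:R * 2 ^+ nu :> R by rewrite {1}nE natrM natrX.
    have : (2 : R) ^+ nu != 0 by rewrite expf_neq0.
    rewrite rmorphD/= -!pmulrn nR; move: (2 ^+ nu) ((2 * m)%N%:R) => v k v0.
    by field.
  by rewrite -phiE.
have AL : A `<=` limsup_nbhd psi.
  move=> x Ax; have := Ax 0%N I; apply: limsup_nbhd_mono => n n1.
  rewrite /phi /val_ge; case: ifP => // _; exact: psi0.
have mL := measurable_limsup_nbhd psi.
apply/eqP; rewrite eq_le measure_ge0 andbT -(zero_one_dyadic_shift mA perA A0 HT).
apply: le_measure; rewrite ?inE; [exact: setD_measurable_itv|exact: setD_measurable_itv|].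
exact: setDS.
Qed.

(** If no single valuation carries a divergent series, removing the valuations one at a time leaves
    every tail [val_ge r] divergent. *)
Lemma limsup_nbhd_full : weighted_diverges eps psi ->
  lebesgue_measure (`[0%R, 1%R] `\` limsup_nbhd psi) = 0%E.
Proof.
move=> div; have [[r Hr]|no] := pselect (exists r, weighted_diverges eps (val_eq r)).
  exact: full_of_val_eq Hr.
apply: full_of_val_ge; elim=> [|r IH].
  suff -> : val_ge 0 = psi by [].
  by apply/funext => n.
apply: weighted_diverges_add (val_ge_split r) IH _.
- exact: val_eq_ge0.
- exact: val_ge_ge0.
- by move=> H; apply: no; exists r.
Qed.

End two_adic.

Theorem theorem1 (R : realType) (psi : nat -> R)
    (psi_ge0 : forall n : nat, (1 <= n)%N -> 0 <= psi n)
    (psi_div : exists2 eps : R, 0 < eps &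
       (\sum_(1 <= n <oo)
          (psi n * (totient n)%:R / (n%:R * log1 n%:R `^ eps))%:E = +oo)%E) :
  (@lebesgue_measure R) (limsup_approx psi) = 1%E /\
  {ae @lebesgue_measure R, forall x : R,
     infinite_set (coprime_solutions psi x)}.
Proof.
have [eps eps0 div] := psi_div.
have null := limsup_nbhd_full psi_ge0 eps0 div.
have mL := measurable_limsup_nbhd psi.
set S := limsup_nbhd psi in null mL.
have mI : measurable (`[0, 1]%classic : set R) by exact: measurable_itv.
have SP x : S x <-> infinite_set [set n : nat | (1 <= n)%N /\ approx_set psi n x].
  exact: iff_trans (limsup_nbhdP psi x) (iff_sym (infinite_natP _)).
split.
  have -> : limsup_approx psi = `[0, 1]%classic `&` S.
    by apply/seteqP; split => x [xI /SP Sx]; split.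
  have <- : lebesgue_measure (`[0, 1]%classic : set R) = 1%E.
    by rewrite lebesgue_measure_itv/= lte_fin ltr01 -EFinB subr0.
  rewrite -[in RHS](setDUK (@subIsetl _ `[0, 1]%classic S)) measureU//.
  - by rewrite setDIr setDv set0U; rewrite -[LHS]adde0; congr (_ + _)%E; exact/esym/null.
  - exact: measurableI.
  - by rewrite setDIr setDv set0U; exact: measurableD.
  - by rewrite setDE setICA setICr setI0.
(* By periodicity the exceptional reals are covered by the integer translates of this null set,
   indexed by a natural number and a sign. *)
pose B := `[0, 1]%classic `\` S.
have mB : measurable B by exact: measurableD.
have neg b : lebesgue_measure.-negligible ((fun x : R => x + b) @^-1` B).
  exists ((fun x : R => x + b) @^-1` B); split => //.
    exact: measurable_shift_preimage.
  by apply: (eq_trans (lebesgue_measure_shift b mB)).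
have : lebesgue_measure.-negligible (\bigcup_(k : nat) (((fun x : R => x + k%:R) @^-1` B) `|` ((fun x : R => x + (- k%:R)) @^-1` B))).
  by apply: negligible_bigcup => k; apply: negligibleU; exact: neg.
apply: negligibleS => x /= fin.
have nS : ~ S x.
  (* Finitely many solutions (a, n) would project onto finitely many denominators. *)
  move=> /SP inf; apply: inf; apply: contrapT => inf; apply: fin => fin; apply: inf.
  apply: (@sub_finite_set _ _ (snd @` coprime_solutions psi x)); last exact: finite_image.
  move=> n /= [n1 /(approx_setP _ _ n1)[a ca ha]]; exists (a, n) => //; split=> //=.
  by rewrite /gcdz/=; apply/eqP; rewrite eqz_nat.
have nSk (k : int) : ~ S (x + k%:~R) by move=> /(limsup_nbhd_shift (- k)); rewrite rmorphN addrK.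
have fl := floor_itv x.
have inB : B (x + (- Num.floor x)%:~R).
  split; last exact: nSk.
  by rewrite /= in_itv/= rmorphN/=; case/andP: fl; rewrite rmorphD/= => f1 f2; apply/andP; split; lra.
move: inB; case: (Num.floor x) => k inB.
  by exists k => //; right; move: inB; rewrite rmorphN/= -pmulrn.
by exists k.+1 => //; left; move: inB; rewrite NegzE opprK -pmulrn.
Qed.
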